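(* There is a distributed randomized algorithm (called ConnectBB) which, from a synchronized start and given a maximal independent set of the communication graph $G$ (each node knowing whether it belongs to it), computes a backbone $H$ of $G$ together with associated protocols Inter$_H$ and Intra$_H$, working in $O(\Delta\log^7N)$ rounds with high probability; the associated protocols have lengths $a_1=O(\log N)$ and $a_2=O(\Delta\log N)$.
   Context: Model: $n$ nodes in the Euclidean plane with unique names in $\{1,\dots,N\}$, $N\ge n$; synchronous rounds, each node transmits or listens, no collision detection; uniform power $P$, constants $\alpha>2$, $\mathcal{N}>0$, $\beta\ge1$, $\varepsilon\in(0,1)$, $r=(P/(\mathcal{N}\beta))^{1/\alpha}$; if set $\mathcal{T}$ transmits, $u\notin\mathcal{T}$ receives the message of $v\in\mathcal{T}$ iff $\frac{P\,\mathrm{dist}(v,u)^{-\alpha}}{\mathcal{N}+\sum_{w\in\mathcal{T}\setminus\{v\}}P\,\mathrm{dist}(w,u)^{-\alpha}}\ge\beta$ and $\mathrm{dist}(v,u)\le(1-\varepsilon)r$. Communication graph $G$: $u\sim v$ iff $\mathrm{dist}(u,v)\le(1-\varepsilon)r$; $\Delta$ its maximum degree. Nodes know only their own name, $N$ and $\Delta$; messages carry $O(\log N)$ control bits (plus possibly a rumor). Synchronized start: all nodes begin in the same round. Backbone of $G$: a subnetwork $H$ whose nodes form a connected dominating set of $G$ of asymptotically the same diameter as $G$, in which every node has a constant number of neighbors in $H$, with $|H|=O(m)$ where $m$ is the size of a smallest connected dominating set of $G$, and where every node of $G\setminus H$ is associated with exactly one of its neighbors in $H$ (its leader). Protocol Inter$_H$: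 a schedule of $a_1$ rounds during which every pair of neighbors in $H$ exchange messages, and every message received by $v\in H$ is delivered to all nodes whose leader is $v$. Protocol Intra$_H$: a schedule of $a_2$ rounds during which the message of each node is delivered to its leader. ''With high probability'': with probability at least $1-n^{-d}$ for a sufficiently large constant $d$. *)

(* Defs.v *)
From Stdlib Require Import Reals ClassicalEpsilon.
From mathcomp Require Import all_boot.

Unset Printing Implicit Defensive.

Delimit Scope R_scope with Re.

Definition to_bool (P : Prop) : bool :=
  if excluded_middle_informative P then true else false.

Definition Rleb (a b : R) : bool := if Rle_dec a b then true else false.

Definition edist (p q : R * R) : R :=
  sqrt ((fst p - fst q) * (fst p - fst q) + (snd p - snd q) * (snd p - snd q))%Re.

Record phys := Phys { pP : R; palpha : R; pnoise : R; pbeta : R; peps : R }.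

Definition phys_ok (ph : phys) : Prop :=
  (0 < pP ph)%Re /\ (2 < palpha ph)%Re /\ (0 < pnoise ph)%Re /\
  (1 <= pbeta ph)%Re /\ (0 < peps ph)%Re /\ (peps ph < 1)%Re.

Definition range (ph : phys) : R :=
  Rpower (pP ph / (pnoise ph * pbeta ph)) (/ palpha ph).

Record network := Net { nn : nat; npos : 'I_nn -> R * R; nname : 'I_nn -> nat }.

Definition nd (G : network) (x y : 'I_(nn G)) : R := edist (npos G x) (npos G y).

Definition power (ph : phys) (G : network) (w y : 'I_(nn G)) : R :=
  (pP ph * Rpower (nd G w y) (- palpha ph))%Re.

Definition rsum {T : finType} (p : pred T) (f : T -> R) : R :=
  foldr Rplus R0 (map f (filter p (enum T))).

Definition rcv (ph : phys) (G : network) (tx : 'I_(nn G) -> bool)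
    (u y : 'I_(nn G)) : bool :=
  [&& tx u, ~~ tx y,
      Rleb (pbeta ph)
        (power ph G u y /
         (pnoise ph + rsum (fun w => tx w && (w != u)) (fun w => power ph G w y)))%Re
    & Rleb (nd G u y) ((1 - peps ph) * range ph)%Re].

Definition adj (ph : phys) (G : network) (x y : 'I_(nn G)) : bool :=
  (x != y) && Rleb (nd G x y) ((1 - peps ph) * range ph)%Re.

Definition degree (ph : phys) (G : network) (x : 'I_(nn G)) : nat :=
  #|[set y | adj ph G x y]|.

Definition max_degree (ph : phys) (G : network) (D : nat) : Prop :=
  (forall x, degree ph G x <= D) /\ (exists x, degree ph G x = D).

Definition graph_connected (ph : phys) (G : network) : Prop :=
  forall x y : 'I_(nn G), connect (adj ph G) x y.

(* reach ph G A k x y: there is a path from x to y of length <= k all of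
   whose vertices lie in A (x is assumed in A by the users). *)
Fixpoint reach (ph : phys) (G : network) (A : {set 'I_(nn G)}) (k : nat)
    (x y : 'I_(nn G)) : Prop :=
  match k with
  | 0 => x = y
  | k'.+1 => reach ph G A k' x y \/
             exists z, reach ph G A k' x z /\ z \in A /\ y \in A /\ adj ph G z y
  end.

Definition diam_le (ph : phys) (G : network) (A : {set 'I_(nn G)}) (k : nat) : Prop :=
  forall x y, x \in A -> y \in A -> reach ph G A k x y.

Definition independent (ph : phys) (G : network) (I : {set 'I_(nn G)}) : Prop :=
  forall x y, x \in I -> y \in I -> ~~ adj ph G x y.

Definition maximal_independent (ph : phys) (G : network) (I : {set 'I_(nn G)}) : Prop :=
  independent ph G I /\ forall x, x \notin I -> exists y, y \in I /\ adj ph G x y.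

Definition is_cds (ph : phys) (G : network) (A : {set 'I_(nn G)}) : Prop :=
  (exists x, x \in A) /\
  (forall x, x \in A \/ exists y, y \in A /\ adj ph G x y) /\
  (forall x y, x \in A -> y \in A -> exists k, reach ph G A k x y).

(* In a round of a schedule a node listens, transmits its own message,
   or transmits (relays) the message it received in an earlier round t'. *)
Inductive act := Listen | Own | Relay of nat.

Definition transmits (a : act) : bool := if a is Listen then false else true.

Section Sched.
Variables (ph : phys) (G : network) (sch : 'I_(nn G) -> nat -> act).

Definition sch_tx (t : nat) : 'I_(nn G) -> bool := fun z => transmits (sch z t).

Inductive carries : 'I_(nn G) -> nat -> 'I_(nn G) -> Prop :=
| carries_own x t : sch x t = Own -> carries x t x
| carries_relay x t t' u o :
    sch x t = Relay t' -> (t' < t)%N -> rcv ph G (sch_tx t') u x ->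
    carries u t' o -> carries x t o.

Definition delivered (a : nat) (o y : 'I_(nn G)) : Prop :=
  exists t u, (t < a)%N /\ rcv ph G (sch_tx t) u y /\ carries u t o.
End Sched.

Definition msg := seq bool.

Record output := Output {
  o_inH : bool;
  o_leader : nat;
  o_inter : nat -> act;
  o_intra : nat -> act
}.

(* A uniform algorithm; every node only knows N, Delta, its own name and
   whether it belongs to the given MIS. In each round t every node draws
   an independent uniform coin in {0,...,K N Delta}. *)
Record algorithm (S : Type) := Algorithm {
  al_T : nat -> nat -> nat;
  al_K : nat -> nat -> nat;                      (* coin range - 1 *)
  al_init : nat -> nat -> nat -> bool -> S;      (* N Delta name inMIS *)
  al_send : nat -> nat -> nat -> S -> nat -> option msg;  (* N Delta t state coin *)
  al_upd : nat -> nat -> nat -> S -> nat -> option msg -> seq msg -> S;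
  al_out : nat -> nat -> S -> output
}.
Arguments al_T {S}. Arguments al_K {S}. Arguments al_init {S}.
Arguments al_send {S}. Arguments al_upd {S}. Arguments al_out {S}.

Section Exec.
Variables (S : Type) (A : algorithm S) (ph : phys) (G : network)
          (N D : nat) (I : {set 'I_(nn G)}).

Definition tape := {ffun ('I_(nn G) * 'I_(al_T A N D)) -> 'I_(al_K A N D).+1}.

Definition coin (w : tape) (x : 'I_(nn G)) (t : nat) : nat :=
  odflt 0%N (omap (fun t' : 'I_(al_T A N D) => nat_of_ord (w (x, t'))) (insub t)).

Definition sends (w : tape) (t : nat) (s : 'I_(nn G) -> S) (x : 'I_(nn G)) :=
  al_send A N D t (s x) (coin w x t).

(* messages heard by y in round t (at most one, since beta >= 1) *)
Definition heard (w : tape) (t : nat) (s : 'I_(nn G) -> S) (y : 'I_(nn G)) : seq msg :=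
  let tx := fun z => isSome (sends w t s z) in
  pmap (fun u => if rcv ph G tx u y then sends w t s u else None) (enum 'I_(nn G)).

Fixpoint state (w : tape) (t : nat) : 'I_(nn G) -> S :=
  match t with
  | 0 => fun x => al_init A N D (nname G x) (x \in I)
  | t'.+1 => fun x =>
      let s := state w t' in
      al_upd A N D t' (s x) (coin w x t') (sends w t' s x) (heard w t' s x)
  end.

Definition final_output (w : tape) (x : 'I_(nn G)) : output :=
  al_out A N D (state w (al_T A N D) x).

Definition prob (E : tape -> Prop) : R :=
  (INR #|[set w : tape | to_bool (E w)]| / INR #|{: tape}|)%Re.
End Exec.

Definition log2N (N : nat) : nat := Nat.log2 N + 1.

Section Correct.
Variables (ph : phys) (G : network) (N Dl c : nat) (o : 'I_(nn G) -> output).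

Definition Hset : {set 'I_(nn G)} := [set x | o_inH (o x)].

Definition leader_of (w v : 'I_(nn G)) : Prop :=
  v \in Hset /\ o_leader (o w) = nname G v.

Definition backbone : Prop :=
  is_cds ph G Hset /\
  (forall A, is_cds ph G A -> #|Hset| <= c * #|A|) /\
  (forall k, diam_le ph G [set: 'I_(nn G)] k -> diam_le ph G Hset (c * k)) /\
  (forall x, #|[set y in Hset | adj ph G x y]| <= c) /\
  (forall w, w \notin Hset ->
     exists v, adj ph G w v /\ leader_of w v /\
               forall v', adj ph G w v' -> leader_of w v' -> v' = v).

Definition inter_ok (a1 : nat) : Prop :=
  let sch := fun z => o_inter (o z) in
  forall u v, u \in Hset -> v \in Hset -> adj ph G u v ->
    delivered ph G sch a1 u v /\
    forall w, w \notin Hset -> leader_of w v -> delivered ph G sch a1 u w.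

Definition intra_ok (a2 : nat) : Prop :=
  let sch := fun z => o_intra (o z) in
  forall w v, w \notin Hset -> leader_of w v -> delivered ph G sch a2 w v.

Definition connectbb_success : Prop :=
  backbone /\
  (exists a1, a1 <= c * log2N N /\ inter_ok a1) /\
  (exists a2, a2 <= c * Dl.+1 * log2N N /\ intra_ok a2).
End Correct.

(* Main.v *)
Require Import Defs.
From Stdlib Require Import Reals Lra Lia ClassicalEpsilon.
From HB Require Import structures.
From mathcomp Require Import all_boot zify.

Set Implicit Arguments.
Unset Strict Implicit.
Unset Printing Implicit Defensive.

(* If every node transmits with probability Theta(1/Delta) in each round, then
   the expected interference at a node is a small constant, because a ball of
   radius k R holds O(k^2 Delta) nodes and alpha > 2. So a fixed node is received
   by a fixed neighbour with probability Omega(1/Delta) per round, and after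
   O(Delta log N) rounds every node has been received by all its neighbours, with
   high probability. As reception depends only on who transmits, replaying the
   same coins repeats all these receptions: five replays let every node learn its
   surroundings within three hops, and the same coins give the protocol Intra.

   The backbone consists of the independent set and a path with at most two inner
   vertices for every two of its members within three hops. Given successful
   replays it is a function of the network, and it has bounded density, so the
   random-transmission argument with probability Theta(1) yields, from fresh
   coins, O(log N) rounds in which backbone nodes are received by all their
   neighbours. Replaying these rounds once per backbone neighbour, now relaying
   what was received from it, gives the protocol Inter. *)

(** * Finite sums and powers of reals *)

HB.instance Definition _ := Monoid.isComLaw.Build R 0%Re Rplus
  (fun x y z => esym (Rplus_assoc x y z)) Rplus_comm Rplus_0_l.

Notation "\rsum_ ( i | P ) F" := (\big[Rplus/0%Re]_(i | P%B) F%Re)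
  (at level 41, F at level 41, i at level 50).

Lemma RlebP (a b : R) : reflect (a <= b)%Re (Rleb a b).
Proof. by rewrite /Rleb; case: Rle_dec => h; constructor. Qed.

Lemma to_boolP (P : Prop) : reflect P (to_bool P).
Proof. by rewrite /to_bool; case: excluded_middle_informative => h; constructor. Qed.

Section RealSums.
Variable T : finType.
Implicit Types (p q : pred T) (f g : T -> R).

Lemma rsumE p f : rsum p f = \rsum_(i | p i) f i.
Proof. by rewrite /rsum foldrE big_map big_filter big_enum_cond. Qed.

Lemma rsum_le p f g : (forall i, p i -> (f i <= g i)%Re) ->
  (\rsum_(i | p i) f i <= \rsum_(i | p i) g i)%Re.
Proof. by move=> h; elim/big_rec2: _ => [|i a b /h]; lra. Qed.

Lemma rsum_ge0 p f : (forall i, p i -> (0 <= f i)%Re) ->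
  (0 <= \rsum_(i | p i) f i)%Re.
Proof. by move=> h; elim/big_rec: _ => [|i a /h]; lra. Qed.

Lemma rsum_sub p q f : (forall i, q i -> (0 <= f i)%Re) ->
  (forall i, p i -> q i) -> (\rsum_(i | p i) f i <= \rsum_(i | q i) f i)%Re.
Proof.
move=> h sub; rewrite big_mkcond [X in (_ <= X)%Re]big_mkcond.
apply: rsum_le => i _; case pi: (p i); first by rewrite (sub _ pi); lra.
by case: ifP => [/h|_]; lra.
Qed.

Lemma rsumZ p f c : (\rsum_(i | p i) (c * f i) = c * \rsum_(i | p i) f i)%Re.
Proof. by elim/big_rec2: _ => [|i a b _ ->]; lra. Qed.

Lemma rsum_const p c : (\rsum_(i | p i) c = INR #|p| * c)%Re.
Proof.
by rewrite big_const; elim: #|p| => [|k IH]; rewrite ?iterS ?S_INR /= ?IH; lra.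
Qed.

End RealSums.

Lemma Rabs_le_inv a b : (Rabs a <= b)%Re -> (- b <= a <= b)%Re.
Proof. by rewrite /Rabs; case: Rcase_abs; lra. Qed.

Lemma INR_expn b k : INR (b ^ k) = (INR b ^ k)%Re.
Proof. by elim: k => //= k IH; rewrite expnS mult_INR IH. Qed.

Lemma Rpower_gt0 x y : (0 < Rpower x y)%Re.
Proof. exact: exp_pos. Qed.

Lemma Rpower_neg_le x y a : (0 < x)%Re -> (x <= y)%Re -> (0 <= a)%Re ->
  (Rpower y (- a) <= Rpower x (- a))%Re.
Proof.
move=> x0 xy a0; rewrite !Rpower_Ropp; apply: Rinv_le_contravar; first exact: Rpower_gt0.
exact: Rle_Rpower_l.
Qed.

(** * Packing in the plane *)

Section Plane.
Variable G : network.
Implicit Types x y z w : 'I_(nn G).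

Lemma nd_euc x y : nd G x y =
  dist_euc (fst (npos G x)) (snd (npos G x)) (fst (npos G y)) (snd (npos G y)).
Proof. by []. Qed.

Lemma nd_sym x y : nd G x y = nd G y x.
Proof. by rewrite !nd_euc distance_symm. Qed.

Lemma nd_refl x : nd G x x = 0%Re.
Proof. by rewrite nd_euc distance_refl. Qed.

Lemma nd_triangle y x z : (nd G x z <= nd G x y + nd G y z)%Re.
Proof. by rewrite !nd_euc; apply: triangle. Qed.

Lemma nd_pos x y : npos G x <> npos G y -> (0 < nd G x y)%Re.
Proof.
rewrite /nd /edist; case: (npos G x) (npos G y) => [a b] [c d] /= ne.
have sq t : t <> 0%Re -> (0 < t * t)%Re by exact: Rlt_0_sqr.
have := Rle_0_sqr (a - c); have := Rle_0_sqr (b - d); rewrite /Rsqr => h1 h2.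
apply: sqrt_lt_R0; have [ac|ac] := Req_dec a c; last first.
  by have := sq (a - c)%Re; lra.
have [bd|bd] := Req_dec b d; first by case: ne; rewrite ac bd.
by have := sq (b - d)%Re; lra.
Qed.

(** Grid cells of side [rho / 2]; the shift by [2 * j] makes the index nonnegative for every [a] of
    absolute value at most [j * rho]. *)
Definition cell (rho a : R) (j : nat) : nat :=
  Z.to_nat (Int_part (2 * a / rho) + 2 * Z.of_nat j)%Z.

Lemma cell_bound rho a j : (0 < rho)%Re -> (Rabs a <= INR j * rho)%Re ->
  (- 2 * Z.of_nat j <= Int_part (2 * a / rho) <= 2 * Z.of_nat j)%Z.
Proof.
move=> r0 /Rabs_le_inv [lo hi].
have e : (2 * a / rho * rho = 2 * a)%Re by field; lra.
have [b1 b2] := base_Int_part (2 * a / rho).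
have jz : INR j = IZR (Z.of_nat j) by rewrite INR_IZR_INZ.
split.
- apply/Z.lt_succ_r/lt_IZR; rewrite succ_IZR mult_IZR -jz; nra.
- apply: le_IZR; rewrite mult_IZR -jz; nra.
Qed.

Lemma cell_ltn rho a j : (0 < rho)%Re -> (Rabs a <= INR j * rho)%Re ->
  cell rho a j < (4 * j).+1.
Proof. by move=> r0 /(cell_bound r0); rewrite /cell; lia. Qed.

Lemma cell_close rho a b j : (0 < rho)%Re -> (Rabs a <= INR j * rho)%Re ->
  (Rabs b <= INR j * rho)%Re -> cell rho a j = cell rho b j ->
  (Rabs (a - b) <= rho / 2)%Re.
Proof.
move=> r0 /(cell_bound r0) ha /(cell_bound r0) hb eq.
have {}eq : Int_part (2 * a / rho) = Int_part (2 * b / rho).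
  by move: eq; rewrite /cell; lia.
have [a1 a2] := base_Int_part (2 * a / rho).
have [b1 b2] := base_Int_part (2 * b / rho).
have ea : (2 * a / rho * rho = 2 * a)%Re by field; lra.
have eb : (2 * b / rho * rho = 2 * b)%Re by field; lra.
rewrite eq in a1 a2.
by apply: Rabs_le; split; nra.
Qed.

Lemma edist_coord (p q : R * R) rho : (edist p q <= rho)%Re ->
  (Rabs (fst p - fst q) <= rho)%Re /\ (Rabs (snd p - snd q) <= rho)%Re.
Proof.
move=> le; split; apply: Rle_trans le; rewrite /edist -sqrt_Rsqr_abs;
  apply: sqrt_le_1_alt; have := Rle_0_sqr (fst p - fst q);
  have := Rle_0_sqr (snd p - snd q); rewrite /Rsqr; lra.
Qed.

Lemma edist_close (p q : R * R) rho : (Rabs (fst p - fst q) <= rho / 2)%Re ->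
  (Rabs (snd p - snd q) <= rho / 2)%Re -> (edist p q <= rho)%Re.
Proof.
move=> h1 h2; rewrite /edist.
have r0 : (0 <= rho)%Re by have := Rabs_pos (fst p - fst q); lra.
rewrite -[X in (_ <= X)%Re](sqrt_Rsqr rho r0); apply: sqrt_le_1_alt.
have sq t : (Rabs t <= rho / 2 -> t * t <= rho / 2 * (rho / 2))%Re.
  by move=> /Rabs_le_inv; nra.
by have := sq _ h1; have := sq _ h2; have := Rle_0_sqr rho; rewrite /Rsqr; lra.
Qed.

(** Only balls centred in [X] are constrained, which is easy to check for an independent set or from
    a degree bound; [packing] passes to arbitrary centres and larger balls. *)
Definition dense_le (rho : R) (X : {set 'I_(nn G)}) (M : nat) : Prop :=
  forall x, x \in X -> #|[set y in X | Rleb (nd G x y) rho]| <= M.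

(** The ball is covered by [(4 * j).+1 ^ 2] cells, and members of [X] in a common cell are within
    [rho] of each other, so each cell holds at most [M] of them. *)
Lemma packing rho (X : {set 'I_(nn G)}) M : (0 < rho)%Re -> dense_le rho X M ->
  forall y j, #|[set w in X | Rleb (nd G w y) (INR j * rho)]| <= M * (4 * j).+1 ^ 2.
Proof.
move=> r0 dX y j; set B := [set w in X | _].
pose dx w := (fst (npos G w) - fst (npos G y))%Re.
pose dy w := (snd (npos G w) - snd (npos G y))%Re.
pose c w : 'I_(4 * j).+1 * 'I_(4 * j).+1 :=
  (inord (cell rho (dx w) j), inord (cell rho (dy w) j)).
have inB w : w \in B -> [/\ w \in X, (Rabs (dx w) <= INR j * rho)%Re &
    (Rabs (dy w) <= INR j * rho)%Re].
  by rewrite inE => /andP[wX /RlebP /edist_coord[]].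
rewrite -sum1_card (partition_big c xpredT) //=.
have -> : M * (4 * j).+1 ^ 2 = \sum_(k : 'I_(4 * j).+1 * 'I_(4 * j).+1) M.
  by rewrite sum_nat_const card_prod card_ord mulnC -mulnn.
apply: leq_sum => k _; rewrite sum1_card.
have [x /andP[xB /eqP cx]|none] := pickP [pred w | (w \in B) && (c w == k)]; last first.
  by rewrite eq_card0 // => w; have := none w.
have [xX xx xy] := inB _ xB.
apply: leq_trans (dX _ xX); apply: subset_leq_card; apply/subsetP => w.
move=> /andP[wB /eqP cw]; have [wX wx wy] := inB _ wB.
rewrite inE wX; apply/RlebP.
have [e1 e2] : cell rho (dx x) j = cell rho (dx w) j /\ cell rho (dy x) j = cell rho (dy w) j.
  have e := etrans cx (esym cw).
  split; [move: (congr1 (fun k => val k.1) e)|move: (congr1 (fun k => val k.2) e)];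
    by rewrite /= !inordK ?cell_ltn.
have h1 := cell_close r0 xx wx e1; have h2 := cell_close r0 xy wy e2.
apply: edist_close; [move: h1|move: h2]; congr (_ <= _)%Re; congr Rabs; rewrite /dx /dy; ring.
Qed.

End Plane.

(** * Interference *)

Section Reception.
Variables (ph : phys) (G : network).
Hypothesis ok : phys_ok ph.
Implicit Types (x y z u w : 'I_(nn G)) (tx : 'I_(nn G) -> bool).

Definition radius : R := ((1 - peps ph) * range ph)%Re.

(** The interference that a reception over distance [radius] tolerates, see [power_radius]; it is
    positive because [radius] falls short of [range] by the factor [1 - peps ph]. *)
Definition margin : R := (pnoise ph * (Rpower (1 - peps ph) (- palpha ph) - 1))%Re.

Lemma radius_gt0 : (0 < radius)%Re.
Proof.
by case: ok => _ [_ [_ [_ [_ e1]]]]; apply: Rmult_lt_0_compat; [lra|exact: exp_pos].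
Qed.

Lemma margin_gt0 : (0 < margin)%Re.
Proof.
case: ok => _ [a2 [n0 [_ [e0 e1]]]]; apply: Rmult_lt_0_compat => //.
suff : (1 < Rpower (1 - peps ph) (- palpha ph))%Re by lra.
rewrite -[X in (X < _)%Re]exp_0; apply: exp_increasing.
have l0 : (ln (1 - peps ph) < 0)%Re by rewrite -ln_1; apply: ln_increasing; lra.
have := @Rmult_lt_0_compat (palpha ph) (- ln (1 - peps ph)); lra.
Qed.

Lemma power_radius : (pP ph * Rpower radius (- palpha ph) =
  pbeta ph * (pnoise ph + margin))%Re.
Proof.
case: ok => p0 [a2 [n0 [b1 [e0 e1]]]].
have q0 : (0 < pP ph / (pnoise ph * pbeta ph))%Re.
  by apply: Rdiv_lt_0_compat => //; apply: Rmult_lt_0_compat; lra.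
rewrite /radius -Rpower_mult_distr; [|lra|exact: exp_pos].
rewrite /range Rpower_mult (_ : / palpha ph * - palpha ph = - (1))%Re; last by field; lra.
rewrite (Rpower_Ropp _ 1) Rpower_1 // /margin; field; lra.
Qed.

Lemma power_ge0 w y : (0 <= power ph G w y)%Re.
Proof.
by case: ok => p0 _; apply/Rlt_le/Rmult_lt_0_compat => //; exact: exp_pos.
Qed.

Lemma adjP x y : reflect (x <> y /\ (nd G x y <= radius)%Re) (adj ph G x y).
Proof.
by apply: (iffP andP) => -[/eqP ne /RlebP le].
Qed.

Lemma adj_sym x y : adj ph G x y = adj ph G y x.
Proof. by rewrite /adj eq_sym nd_sym. Qed.

Lemma rcv_adj tx u y : rcv ph G tx u y -> adj ph G u y.
Proof.
case/and4P=> tu ty _ le; rewrite /adj le andbT; apply: contraNneq ty => <-; exact: tu.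
Qed.

(** Silencing other transmitters only lowers the interference. Protocol Inter relies on this, since
    its replayed rounds may lack some transmitters. *)
Lemma rcv_sub tx tx' u y : (forall w, tx' w -> tx w) -> tx' u ->
  rcv ph G tx u y -> rcv ph G tx' u y.
Proof.
move=> sub tu /and4P[_ ty /RlebP le near]; case: ok => _ [_ [n0 [b1 _]]].
apply/and4P; split=> //; first by apply: contra ty; exact: sub.
apply/RlebP; apply: Rle_trans le _; rewrite !rsumE.
have ge0 : (0 <= \rsum_(w | tx' w && (w != u)) power ph G w y)%Re.
  by apply: rsum_ge0 => w _; apply: power_ge0.
apply: Rmult_le_compat_l; first exact: power_ge0.
apply: Rinv_le_contravar; first lra.
apply: Rplus_le_compat_l; apply: rsum_sub => [w _|w /andP[/sub -> ->]] //.
exact: power_ge0.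
Qed.

(* Transmitters other than [u] of total weight below 1 do not disturb the
   reception of a neighbour [u] at [y]. *)
Definition weight y w : R :=
  if Rleb (nd G w y) radius then 1%Re else (power ph G w y / margin)%Re.

Lemma weight_ge0 y w : (0 <= weight y w)%Re.
Proof.
rewrite /weight; case: ifP => _; first lra.
by apply: Rmult_le_pos; [exact: power_ge0|apply/Rlt_le/Rinv_0_lt_compat/margin_gt0].
Qed.

(** A node within [radius] of [y], in particular [y] itself, already weighs 1. So [y] is silent, all
    other transmitters are far, and their interference is at most [margin]. *)
Lemma rcv_weight tx u y : npos G u <> npos G y -> tx u -> adj ph G u y ->
  (\rsum_(w | tx w && (w != u)) weight y w < 1)%Re -> rcv ph G tx u y.
Proof.
move=> npuy tu /adjP[ne le] sum1; case: ok => p0 [a2 [n0 [b1 _]]].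
have m0 := margin_gt0.
have light w : tx w && (w != u) -> (weight y w < 1)%Re.
  move=> tw; move: sum1; rewrite (bigD1 w) //=.
  have /= := @rsum_ge0 _ (fun i => tx i && (i != u) && (i != w)) (weight y)
    (fun i _ => weight_ge0 y i); lra.
have far w : tx w && (w != u) -> weight y w = (power ph G w y / margin)%Re.
  by move/light; rewrite /weight; case: ifP => //; lra.
apply/and4P; split=> //; last exact/RlebP.
  apply/negP => ty; have /light : tx y && (y != u) by rewrite ty; apply/eqP => /esym.
  by rewrite /weight nd_refl; case: RlebP => [|[]]; have := radius_gt0; lra.
apply/RlebP; rewrite rsumE.
set I := (\rsum_(_ | _) _)%Re.
have I0 : (0 <= I)%Re by apply: rsum_ge0 => w _; apply: power_ge0.
have Im : (I <= margin)%Re.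
  move: sum1; rewrite (eq_bigr (fun w => / margin * power ph G w y)%Re); last first.
    by move=> w /far ->; rewrite Rmult_comm.
  rewrite rsumZ -/I => h; apply: Rlt_le; apply: (Rmult_lt_reg_l (/ margin)).
    exact: Rinv_0_lt_compat.
  by rewrite Rinv_l; lra.
have pw : (pbeta ph * (pnoise ph + margin) <= power ph G u y)%Re.
  rewrite -power_radius; apply: Rmult_le_compat_l; first lra.
  by apply: Rpower_neg_le => //; [exact: nd_pos|lra].
apply: (Rmult_le_reg_r (pnoise ph + I)); first lra.
rewrite /Rdiv Rmult_assoc Rinv_l; last lra.
by rewrite Rmult_1_r; nra.
Qed.

Definition decay : R := Rpower 2 (- palpha ph).

(* The ball of radius [R] holds at most [25 M] nodes, and the ball of radius
   [2^(j+1) R] at most [81 * 4^j M], each of them beyond distance [2^j R]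
   contributing at most [decay^j] times the power received at distance [R]. *)
Definition kappa : R :=
  (25 + (pbeta ph * (pnoise ph + margin) / margin) * (81 / (1 - 4 * decay)))%Re.

(** Doubling the radius multiplies the bound on the number of nodes by 4 and the received power by
    [decay]; as alpha exceeds 2 the product is below 1, so the shells sum up as a geometric
    series. *)
Lemma decay_bounds : (0 < decay)%Re /\ (4 * decay < 1)%Re.
Proof.
split; first exact: exp_pos.
have [_ [a2 _]] := ok.
suff : (decay < / 4)%Re by lra.
rewrite (_ : 4 = Rpower 2 2)%Re; last by rewrite (_ : 2 = INR 2)%Re // Rpower_pow /=; lra.
by rewrite -Rpower_Ropp; apply: Rpower_lt; lra.
Qed.

Lemma Rpower_dyadic j : (Rpower (2 ^ j * radius) (- palpha ph) =
  decay ^ j * Rpower radius (- palpha ph))%Re.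
Proof.
have r0 := radius_gt0.
elim: j => [|j IH] /=; first by rewrite !Rmult_1_l.
rewrite Rmult_assoc -Rpower_mult_distr ?IH /decay; [lra|lra|].
by apply: Rmult_lt_0_compat => //; apply: pow_lt; lra.
Qed.

Lemma geometric_le (b : R) J : (0 <= b)%Re -> (b < 1)%Re ->
  (\big[Rplus/0%Re]_(j < J) (b ^ j)%Re <= / (1 - b))%Re.
Proof.
move=> b0 b1.
have -> : (\big[Rplus/0%Re]_(j < J) (b ^ j)%Re = (1 - b ^ J) / (1 - b))%Re.
  elim: J => [|J IH]; first by rewrite big_ord0 /=; field; lra.
  by rewrite big_ord_recr /= IH; field; lra.
rewrite -[X in (_ <= X)%Re]Rmult_1_l; apply: Rmult_le_compat_r.
  by apply/Rlt_le/Rinv_0_lt_compat; lra.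
by have := pow_le b J b0; lra.
Qed.

Lemma dyadic_shell y : exists J, forall w, (radius < nd G w y)%Re ->
  exists j : 'I_J, (2 ^ j * radius <= nd G w y <= 2 ^ j.+1 * radius)%Re.
Proof.
have r0 := radius_gt0.
have nd0 w : (0 <= nd G w y)%Re by apply: sqrt_pos.
(* The sum of all distances to [y] bounds each of them, so one [J] serves every [w]. *)
have [J hJ] : exists J, (\rsum_(w | true) nd G w y <= 2 ^ J * radius)%Re.
  have [J hJ] := Pow_x_infinity 2 ltac:(rewrite Rabs_pos_eq; lra)
    ((\rsum_(w | true) nd G w y) / radius)%Re.
  exists J; have := hJ J (le_n J); rewrite Rabs_pos_eq => [h|]; last by apply: pow_le; lra.
  apply: (Rmult_le_reg_r (/ radius)); first exact: Rinv_0_lt_compat.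
  by rewrite Rmult_assoc Rinv_r; lra.
exists J => w far.
have : (nd G w y <= 2 ^ J * radius)%Re.
  apply: Rle_trans hJ; rewrite (bigD1 w) //=.
  have /= := @rsum_ge0 _ (fun i => i != w) (fun i => nd G i y) (fun i _ => nd0 i); lra.
clear hJ; elim: J => [|J IH] le; first by rewrite /= in le; lra.
have [/IH[j hj]|gt] := Rle_lt_dec (nd G w y) (2 ^ J * radius).
  by exists (widen_ord (leqnSn J) j).
by exists ord_max; split=> //=; lra.
Qed.

Lemma weight_sum (X : {set 'I_(nn G)}) M y : dense_le radius X M ->
  (\rsum_(w | w \in X) weight y w <= INR M * kappa)%Re.
Proof.
move=> dX; have r0 := radius_gt0; have m0 := margin_gt0.
have [d0 d1] := decay_bounds.
have [p0 [a2 [n0 [b1 _]]]] := ok.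
have [J hJ] := dyadic_shell y.
pose c := (pbeta ph * (pnoise ph + margin) / margin)%Re.
have c0 : (0 < c)%Re by apply: Rdiv_lt_0_compat => //; apply: Rmult_lt_0_compat; lra.
pose ind k w := (if Rleb (nd G w y) (INR k * radius) then 1 else 0)%Re.
have ind0 k w : (0 <= ind k w)%Re by rewrite /ind; case: ifP => _; lra.
have pack k : (\rsum_(w | w \in X) ind k w <= INR (M * (4 * k).+1 ^ 2))%Re.
  rewrite -big_mkcondr rsum_const Rmult_1_r; apply/le_INR/leP.
  by apply: leq_trans (packing r0 dX y k); rewrite cardsE.
(* A near node is charged to the first term, a node of shell [j] to the [j]-th term of the sum; the
   remaining terms are nonnegative. *)
have pointwise w : (weight y w <= ind 1%N w +
    \big[Rplus/0%Re]_(j < J) (c * decay ^ j * ind (2 ^ j.+1)%N w))%Re.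
  have s0 (P : pred 'I_J) : (0 <= \rsum_(j | P j) (c * decay ^ j * ind (2 ^ j.+1)%N w))%Re.
    by apply: rsum_ge0 => j _; apply: Rmult_le_pos => //; apply: Rmult_le_pos;
      [lra|apply: pow_le; lra].
  rewrite /weight {1}/ind (_ : INR 1 * radius = radius)%Re; last by rewrite /=; lra.
  case: RlebP => [_|/Rnot_le_lt /hJ [j [lo hi]]].
    by have /= := s0 xpredT; lra.
  rewrite (bigD1 j) //=; have /= := s0 (fun i => i != j).
  rewrite {2}/ind; case: RlebP => [_|[]]; last first.
    by rewrite INR_expn; exact: hi.
  set rest := (\big[Rplus/0%Re]_(_ < _ | _) _)%Re => rest0.
  suff : (power ph G w y / margin <= c * decay ^ j)%Re by clearbody c rest; lra.
  clear rest rest0.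
  rewrite /c -power_radius.
  have -> : (pP ph * Rpower radius (- palpha ph) / margin * decay ^ j =
      pP ph * (decay ^ j * Rpower radius (- palpha ph)) / margin)%Re by field; lra.
  rewrite -Rpower_dyadic; apply: Rmult_le_compat_r; first exact/Rlt_le/Rinv_0_lt_compat.
  apply: Rmult_le_compat_l; first lra.
  apply: Rpower_neg_le => //; last lra.
  by apply: Rmult_lt_0_compat => //; apply: pow_lt; lra.
apply: Rle_trans (rsum_le (fun w _ => pointwise w)) _.
rewrite big_split exchange_big /= /kappa -/c Rmult_plus_distr_l.
apply: Rplus_le_compat.
  by apply: Rle_trans (pack 1%N) _; rewrite mult_INR -/(5 ^ 2); rewrite /=; lra.
apply: (@Rle_trans _ (\big[Rplus/0%Re]_(j < J) (INR M * c * 81 * (4 * decay) ^ j)%Re)).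
  apply: rsum_le => j _; rewrite rsumZ.
  have dj : (0 <= decay ^ j)%Re by apply: pow_le; lra.
  apply: (@Rle_trans _ (c * decay ^ j * INR (M * 81 * 4 ^ j))%Re).
    apply: Rmult_le_compat_l; first by apply: Rmult_le_pos; lra.
    apply: Rle_trans (pack _) _; apply/le_INR/leP; rewrite -mulnA leq_mul2l.
    (* The side [4 * 2 ^ j.+1 + 1] is at most [9 * 2 ^ j], whose square is [81 * 4 ^ j]. *)
    apply/orP; right; rewrite (_ : 81 = 9 ^ 2) // (_ : 4 ^ j = (2 ^ j) ^ 2) -?expnMn.
      by rewrite leq_exp2r // expnS; have := expn_gt0 2 j; lia.
    by rewrite -expnM mulnC expnM.
  rewrite !mult_INR (_ : INR (4 ^ j) = 4 ^ j)%Re; last first.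
    by rewrite INR_expn; congr (_ ^ _)%Re; rewrite /=; lra.
  by rewrite Rpow_mult_distr (_ : INR 81 = 81)%Re; [lra|rewrite INR_IZR_INZ].
rewrite rsumZ (_ : INR M * (c * (81 / (1 - 4 * decay))) = INR M * c * 81 * / (1 - 4 * decay))%Re; last by rewrite /Rdiv; ring.
apply: Rmult_le_compat_l; last by apply: geometric_le; lra.
by apply: Rmult_le_pos; [apply: Rmult_le_pos; [exact: pos_INR|lra]|lra].
Qed.

Lemma kappa_ge25 : (25 <= kappa)%Re.
Proof.
have [d0 d1] := decay_bounds; have m0 := margin_gt0; have [p0 [a2 [n0 [b1 _]]]] := ok.
suff : (0 <= pbeta ph * (pnoise ph + margin) / margin * (81 / (1 - 4 * decay)))%Re.
  by rewrite /kappa; lra.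
apply: Rmult_le_pos; apply/Rlt_le/Rdiv_lt_0_compat; try lra.
by apply: Rmult_lt_0_compat; lra.
Qed.

End Reception.

(** * Random transmissions *)

(** Independence of the coordinates of a uniform function, in counting form. *)
Lemma card_ffun_forall_in (aT rT : finType) (S : {set aT}) (P : pred rT) :
  #|[set f : {ffun aT -> rT} | [forall x in S, P (f x)]]| =
  #|P| ^ #|S| * #|rT| ^ #|~: S|.
Proof.
pose F x : pred rT := if x \in S then P else predT.
have -> : #|[set f : {ffun aT -> rT} | [forall x in S, P (f x)]]| = #|family F|.
  apply: eq_card => f; rewrite inE; apply/forallP/familyP => h x; move: (h x); rewrite /F.
    by case: (x \in S).
  by case: (x \in S).
rewrite card_family foldrE big_map big_enum /= (bigID [in S]) /=.
rewrite (eq_bigr (fun=> #|P|)) => [|x]; last by rewrite /F => ->.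
rewrite [X in _ * X](eq_bigr (fun=> #|rT|)) => [|x]; last by rewrite /F => /negbTE ->.
rewrite !prod_nat_const; congr (_ * _ ^ _).
by apply: eq_card => x; rewrite !inE.
Qed.

(** Independence of rounds: currying turns a tape into a function from rounds to columns, to which
    [card_ffun_forall_in] applies. *)
Lemma card_columns_forall_in (aT bT rT : finType) (B : {set bT}) (P : pred {ffun aT -> rT}) :
  #|[set w : {ffun aT * bT -> rT} | [forall t in B, P [ffun x => w (x, t)]]]| =
  #|P| ^ #|B| * #|{ffun aT -> rT}| ^ #|~: B|.
Proof.
rewrite -(card_ffun_forall_in B P).
pose curry (w : {ffun aT * bT -> rT}) := [ffun t => [ffun x => w (x, t)]].
have bij : bijective curry.
  exists (fun f : {ffun bT -> {ffun aT -> rT}} => [ffun p => f p.2 p.1]) => [w|f].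
    by apply/ffunP => -[x t]; rewrite !ffunE.
  by apply/ffunP => t; apply/ffunP => x; rewrite !ffunE.
rewrite -(on_card_preimset (onW_bij _ bij)); apply: eq_card => w; rewrite !inE.
by apply: eq_forallb => t; rewrite ffunE.
Qed.

(** Since [1 - x <= exp (- x)], a block of [2 * K] factors is at most [1 / e], hence at most 1/2. *)
Lemma pow_half_le K m : 0 < K -> ((1 - / (2 * INR K)) ^ (2 * K * m) <= (/ 2) ^ m)%Re.
Proof.
move=> K0; have k1 : (1 <= INR K)%Re by rewrite -[1%Re]/(INR 1); apply/le_INR/leP.
rewrite pow_mult; apply: pow_incr; set x := (/ (2 * INR K))%Re.
have xk : (x * (2 * INR K) = 1)%Re by rewrite /x; field; lra.
have x0 : (0 < x)%Re by apply: Rinv_0_lt_compat; lra.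
have x1 : (x <= 1)%Re by nra.
split; first by apply: pow_le; lra.
apply: (@Rle_trans _ (exp (- x) ^ (2 * K)%N)).
  apply: pow_incr; split; first lra.
  by have := exp_ineq1_le (- x); lra.
rewrite -Rpower_pow ?ln_exp; last exact: exp_pos.
rewrite /Rpower ln_exp mult_INR (_ : INR 2 * INR K * - x = - (1))%Re; last by rewrite /=; lra.
rewrite exp_Ropp; apply: Rinv_le_contravar; first lra.
by have := exp_ineq1_le 1; lra.
Qed.

Section Broadcast.
Variables (ph : phys) (G : network) (q : nat).
Hypothesis ok : phys_ok ph.
Hypothesis npos_inj : forall x y : 'I_(nn G), x <> y -> npos G x <> npos G y.
Variables (X : {set 'I_(nn G)}) (M z : nat) (u y : 'I_(nn G)).
Hypotheses (dX : dense_le (radius ph) X M) (uX : u \in X) (uy : adj ph G u y).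

Notation column := {ffun 'I_(nn G) -> 'I_q.+1}.
Definition active (col : column) : pred 'I_(nn G) := fun w => (w \in X) && (col w < z).

Lemma card_small : z <= q.+1 -> #|[pred c : 'I_q.+1 | c < z]| = z.
Proof.
by move=> zq; rewrite -sum1_card -(big_ord_widen _ (fun=> 1) zq) sum1_card card_ord.
Qed.

(** Let [p = z / q.+1]. Node [u] transmits with probability [p]; given this, the other transmitters
    have expected weight at most [p * M * kappa <= 1 / 2], so by Markov's inequality they reach
    weight 1 with probability at most 1/2. Hence success has probability at least [p / 2]. *)
Lemma column_success : (2 * INR M * kappa ph * INR z <= INR q.+1)%Re -> z <= q.+1 ->
  (INR z * INR #|{: column}| <=
   2 * INR q.+1 * INR #|[pred col : column | rcv ph G (active col) u y]|)%Re.
Proof.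
move=> hz zq; set Q := INR q.+1; set tot := INR #|{: column}|.
have Q0 : (0 < Q)%Re by apply/lt_0_INR/ltP.
have tot0 : (0 <= tot)%Re by exact: pos_INR.
have z0 : (0 <= INR z)%Re by exact: pos_INR.
have cnt (S : {set 'I_(nn G)}) :
    (INR #|[set f : column | [forall x in S, (f x < z)%N]]| * Q ^ #|S| =
     INR z ^ #|S| * tot)%Re.
  rewrite (card_ffun_forall_in S [pred c : 'I_q.+1 | c < z]) card_small //.
  rewrite mult_INR !INR_expn /tot card_ffun card_ord -(cardsC S) INR_expn -/Q.
  by rewrite pow_add; ring.
have cnt1 : (INR #|[set f : column | (f u < z)%N]| * Q = INR z * tot)%Re.
  have := cnt [set u]; rewrite cards1 !pow_1 => <-; congr (INR _ * _)%Re.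
  apply: eq_card => f; rewrite !inE; apply/idP/forall_inP => [h x|/(_ u)].
    by rewrite inE => /eqP ->.
  by rewrite inE eqxx; apply.
have cnt2 w : w != u ->
    (INR #|[set f : column | (f u < z)%N && (f w < z)%N]| * (Q * Q) = INR z * INR z * tot)%Re.
  move=> wu; have := cnt [set u; w]; rewrite cards2 eq_sym wu /= !Rmult_1_r => <-.
  congr (INR _ * _)%Re.
  apply: eq_card => f; rewrite !inE; apply/andP/forall_inP => [[h1 h2] x|h].
    by rewrite !inE => /orP[] /eqP ->.
  by split; apply: h; rewrite !inE eqxx ?orbT.
pose load (f : column) := (\rsum_(w | active f w && (w != u)) weight ph y w)%Re.
have load0 f : (0 <= load f)%Re by apply: rsum_ge0 => w _; apply: weight_ge0.
pose heavy := [set f : column | (f u < z) && ~~ rcv ph G (active f) u y].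
have markov : (INR #|heavy| <= \rsum_(f | ((f : column) u < z)%N) load f)%Re.
  apply: (@Rle_trans _ (\rsum_(f | f \in heavy) load f)); last first.
    by apply: rsum_sub => // f; rewrite inE => /andP[].
  rewrite -[X in (X <= _)%Re]Rmult_1_r -(rsum_const [in heavy]); apply: rsum_le => f /=.
  rewrite inE => /andP[fu /negP nr]; apply: Rnot_lt_le => l1; apply: nr.
  apply: rcv_weight => //; last by rewrite /active uX.
  by apply: npos_inj; case/adjP: uy.
(* After exchanging the sums, pairwise independence gives every [w] other than [u] the same factor,
   and [weight_sum] bounds the total weight. *)
have expect : ((\rsum_(f | ((f : column) u < z)%N) load f) * (Q * Q) <=
    INR z * INR z * tot * (INR M * kappa ph))%Re.
  rewrite /load; under eq_bigr => f fu.
    rewrite big_mkcond; over.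
  rewrite exchange_big /= Rmult_comm -rsumZ.
  apply: (@Rle_trans _ (\rsum_(w | w \in X) (INR z * INR z * tot * weight ph y w))).
    rewrite [X in (_ <= X)%Re]big_mkcond; apply: rsum_le => w _.
    rewrite /active -big_mkcondr; have [wX|wX] := boolP (w \in X); last first.
      by rewrite big_pred0 /=; [lra|move=> f; rewrite andbF].
    have [->|wu] := eqVneq w u.
      rewrite big_pred0 => [|f]; last by rewrite !andbF.
      rewrite Rmult_0_r; apply: Rmult_le_pos (weight_ge0 ok y u).
      by apply: Rmult_le_pos => //; apply: Rmult_le_pos.
    rewrite rsum_const -(cnt2 _ wu).
    have -> : #|[pred f : column | (f u < z) && (true && (f w < z) && true)]| =
       #|[set f : column | (f u < z) && (f w < z)]|.
      by apply: eq_card => f; rewrite !inE /= andbT.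
    by apply: Req_le; ring.
  rewrite rsumZ; apply: Rmult_le_compat_l; last exact: weight_sum.
  by apply: Rmult_le_pos => //; apply: Rmult_le_pos.
have split : (INR #|[set f : column | (f u < z)%N]| <=
    INR #|heavy| + INR #|[pred col : column | rcv ph G (active col) u y]|)%Re.
  rewrite -plus_INR; apply/le_INR/leP.
  rewrite -[in X in _ <= _ + X]cardsE; apply: leq_trans (leq_card_setU _ _).
  apply: subset_leq_card; apply/subsetP => f; rewrite !inE => ->.
  by rewrite orNb.
have bound : (INR #|heavy| * (2 * Q) <= INR z * tot)%Re.
  apply: (Rmult_le_reg_r Q) => //.
  have -> : (INR #|heavy| * (2 * Q) * Q = 2 * (INR #|heavy| * (Q * Q)))%Re by ring.
  apply: (@Rle_trans _ (2 * (INR z * INR z * tot * (INR M * kappa ph)))).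
    apply: Rmult_le_compat_l; first lra.
    apply: Rle_trans expect; apply: Rmult_le_compat_r => //; nra.
  have -> : (2 * (INR z * INR z * tot * (INR M * kappa ph)) =
    INR z * tot * (2 * INR M * kappa ph * INR z))%Re by ring.
  by apply: Rmult_le_compat_l => //; apply: Rmult_le_pos.
nra.
Qed.

(* [K] bounds the inverse of the transmission probability [z / q.+1]. *)
Lemma broadcast_failure T (B : {set 'I_T}) K m :
  (2 * INR M * kappa ph * INR z <= INR q.+1)%Re -> z <= q.+1 -> q.+1 <= K * z ->
  #|B| = 2 * K * m ->
  (INR #|[set w : {ffun 'I_(nn G) * 'I_T -> 'I_q.+1} |
      [forall t in B, ~~ rcv ph G (active [ffun x => w (x, t)]) u y]]|
   <= (/ 2) ^ m * INR #|{: {ffun 'I_(nn G) * 'I_T -> 'I_q.+1}}|)%Re.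
Proof.
move=> hz zq qK cB; have := column_success hz zq.
set good := [pred col : column | _] => suc.
have K0 : 0 < K by move: qK; case: (K).
have k0 : (0 < INR K)%Re by apply/lt_0_INR/ltP.
have Q0 : (0 < INR q.+1)%Re by apply/lt_0_INR/ltP.
have t0 : (0 <= INR #|{: column}|)%Re by exact: pos_INR.
have qK' : (INR q.+1 <= INR K * INR z)%Re by rewrite -mult_INR; apply/le_INR/leP.
rewrite (card_columns_forall_in B (fun col => ~~ good col)).
have -> : #|{: {ffun 'I_(nn G) * 'I_T -> 'I_q.+1}}| =
    (#|{: column}| ^ #|B| * #|{: column}| ^ #|~: B|)%N.
  by rewrite -expnD cardsC !card_ffun card_prod !card_ord expnM.
rewrite !mult_INR !INR_expn cB -Rmult_assoc; apply: Rmult_le_compat_r; first exact: pow_le.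
(* One round succeeds with probability at least [z / (2 * q.+1)], hence at least [1 / (2 * K)]; the
   rounds in [B] are independent. *)
apply: Rle_trans (Rmult_le_compat_r _ _ _ _ (pow_half_le m K0)); last exact: pow_le.
rewrite -Rpow_mult_distr; apply: pow_incr; split; first exact: pos_INR.
set bad := INR #|_|.
have : (INR #|good| + bad = INR #|{: column}|)%Re.
  by rewrite /bad -plus_INR -(cardC good); congr (INR (_ + _)); apply: eq_card.
suff : (INR #|{: column}| * / (2 * INR K) <= INR #|good|)%Re by lra.
apply: (Rmult_le_reg_r (2 * INR K * INR q.+1)).
  by apply: Rmult_lt_0_compat => //; lra.
have -> : (INR #|{: column}| * / (2 * INR K) * (2 * INR K * INR q.+1) =
  INR #|{: column}| * INR q.+1)%Re by field; lra.
apply: (@Rle_trans _ (INR K * (INR z * INR #|{: column}|))); first nra.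
by have := Rmult_le_compat_l _ _ _ (Rlt_le _ _ k0) suc; lra.
Qed.

End Broadcast.

(** * Local computations *)

Section Encoding.
Variable b : nat.

(** Any fixed enumeration of the words of length [b] gives a fixed-length code, so messages are
    decoded block by block. *)
Definition words : seq (seq bool) := [seq tval s | s <- enum {: b.-tuple bool}].
Definition bits (n : nat) : seq bool := nth [::] words n.
Definition encode (l : seq nat) : msg := flatten (map bits l).
Definition decode (m : msg) : seq nat :=
  [seq index s words | s <- reshape (nseq (size m %/ b) b) m].

Lemma size_words : size words = 2 ^ b.
Proof. by rewrite size_map -cardE card_tuple card_bool. Qed.

Lemma size_bits n : n < 2 ^ b -> size (bits n) = b.
Proof.
rewrite -size_words => n2; have /mapP[s _ e] := mem_nth [::] n2.
by rewrite /bits e size_tuple.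
Qed.

Lemma bitsK n : n < 2 ^ b -> index (bits n) words = n.
Proof.
move=> n2; rewrite index_uniq ?size_words //.
by rewrite map_inj_uniq ?enum_uniq //; apply: val_inj.
Qed.

Lemma size_encode l : all (fun n => n < 2 ^ b) l -> size (encode l) = size l * b.
Proof.
by elim: l => //= n l IH /andP[n2 /IH e]; rewrite size_cat -/(encode l) e size_bits.
Qed.

Lemma encodeK l : 0 < b -> all (fun n => n < 2 ^ b) l -> decode (encode l) = l.
Proof.
move=> b0 hl; rewrite /decode size_encode // mulnK //.
have -> : nseq (size l) b = shape (map bits l).
  by elim: l hl => //= n l IH /andP[n2 /IH <-]; rewrite size_bits.
rewrite flattenK -map_comp; apply: map_id_in => n /(allP hl); exact: bitsK.
Qed.

End Encoding.

Lemma ltn_log2N N n : n <= N -> n < 2 ^ log2N N.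
Proof.
have powE k : Nat.pow 2 k = 2 ^ k by elim: k => //= k ->; rewrite expnS; lia.
move=> nN; apply: leq_ltn_trans nN _; rewrite /log2N addn1 -powE.
by case: N => // N; have [|_ /ltP] := Nat.log2_spec N.+1; first by lia.
Qed.

(* A node's local computation. The message of phase [i] is its sender's name
   followed by a list of names; [h i] are the messages heard in phase [i], and
   a view additionally contains the node's own message. After phases 0, 1, 2 a
   node knows the members of the independent set within 1, 2, 3 hops; in
   phases 3 and 4 the first and the second inner vertex of a path to each
   member of the independent set within 3 hops are nominated. *)
Section Local.
Variables (N nm : nat) (mis : bool).

(** Filtering a range of names, rather than concatenating the tails, makes the result depend only on
    the set of messages in [V]: the order and multiplicity of receptions are random. *)
Definition items (V : seq (seq nat)) : seq nat :=
  [seq b <- iota 0 N.+1 | has (fun l : seq nat => b \in behead l) V].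

(** Taking the least sender that lists [b] is again a choice determined by the set of messages
    alone. *)
Definition witness (V : seq (seq nat)) (b : nat) : nat :=
  head 0 [seq y <- iota 0 N.+1 |
    has (fun l : seq nat => (head 0 l == y) && (b \in behead l)) V].

Variable h : nat -> seq (seq nat).

Definition content0 := nm :: nseq mis nm.
Definition view0 := content0 :: h 0.
Definition content1 := nm :: items view0.
Definition view1 := content1 :: h 1.
Definition content2 := nm :: items view1.
Definition view2 := content2 :: h 2.
Definition content3 := nm :: (if mis then map (witness view2) (items view2) else [::]).
Definition view3 := content3 :: h 3.
(** A nominated first inner vertex does not know for which target it was chosen, so it nominates
    towards every independent node within two hops. *)
Definition content4 :=
  nm :: (if nm \in items view3 then map (witness view1) (items view1) else [::]).
Definition view4 := content4 :: h 4.

Definition content (i : nat) : seq nat :=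
  nth [::] [:: content0; content1; content2; content3; content4] i.

Definition in_backbone : bool :=
  [|| mis, nm \in items view3 | nm \in items view4].

(** The least name of an independent node within one hop; by maximality there is one, so the default
    0 is never taken. *)
Definition leader : nat := head 0 (items view0).

End Local.

Lemma eq_items N V V' : V =i V' -> items N V = items N V'.
Proof. by move=> e; apply: eq_filter => b; apply: eq_has_r. Qed.

Lemma eq_witness N V V' : V =i V' -> witness N V =1 witness N V'.
Proof.
by move=> e b; rewrite /witness; congr head; apply: eq_filter => y; apply: eq_has_r.
Qed.

Lemma eq_witnesses N V V' : V =i V' ->
  map (witness N V) (items N V) = map (witness N V') (items N V').
Proof. by move=> e; rewrite (eq_items N e); apply: eq_map; apply: eq_witness. Qed.

Lemma eq_mem_cons (T : eqType) (x : T) s s' : s =i s' -> x :: s =i x :: s'.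
Proof. by move=> e y; rewrite !inE e. Qed.

(** A phase looks only at earlier phases, and only at the sets of messages heard there. This permits
    the comparison of the random execution with the lossless one. *)
Lemma eq_content N nm mis h h' i : (forall j, j < i -> h j =i h' j) ->
  content N nm mis h i = content N nm mis h' i.
Proof.
have e1 : h 0 =i h' 0 -> content1 N nm mis h = content1 N nm mis h'.
  by move=> e; congr cons; apply: eq_items; apply: eq_mem_cons.
have v1 : h 0 =i h' 0 -> h 1 =i h' 1 -> view1 N nm mis h =i view1 N nm mis h'.
  by move=> /e1 e f; rewrite /view1 e; apply: eq_mem_cons.
have e2 : h 0 =i h' 0 -> h 1 =i h' 1 -> content2 N nm mis h = content2 N nm mis h'.
  by move=> e /(v1 e) f; congr cons; apply: eq_items.
have e3 : h 0 =i h' 0 -> h 1 =i h' 1 -> h 2 =i h' 2 ->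
    content3 N nm mis h = content3 N nm mis h'.
  move=> e f g; congr cons; congr (if _ then _ else _); apply: eq_witnesses.
  by rewrite /view2 e2 //; apply: eq_mem_cons.
case: i => [|[|[|[|[|i]]]]] hh; rewrite /content /=.
- by [].
- exact/e1/hh.
- by apply: e2; apply: hh.
- by apply: e3; apply: hh.
- have v3 : view3 N nm mis h =i view3 N nm mis h'.
    by rewrite /view3 e3; try exact: hh; apply: eq_mem_cons; apply: hh.
  congr cons; rewrite (eq_items N v3); congr (if _ then _ else _); apply: eq_witnesses.
  by apply: v1; apply: hh.
- by rewrite !nth_nil.
Qed.

Lemma eq_views N nm mis h h' : (forall j, j < 5 -> h j =i h' j) ->
  [/\ view0 nm mis h =i view0 nm mis h', view3 N nm mis h =i view3 N nm mis h' &
      view4 N nm mis h =i view4 N nm mis h'].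
Proof.
move=> hh; split.
- by apply: eq_mem_cons; apply: hh.
- rewrite /view3 -![content3 _ _ _ _]/(content N nm mis _ 3) (@eq_content _ _ _ h h').
    by apply: eq_mem_cons; apply: hh.
  by move=> j j3; apply: hh; lia.
- rewrite /view4 -![content4 _ _ _ _]/(content N nm mis _ 4) (@eq_content _ _ _ h h').
    by apply: eq_mem_cons; apply: hh.
  by move=> j j3; apply: hh; lia.
Qed.

Lemma eq_in_backbone N nm mis h h' : (forall j, j < 5 -> h j =i h' j) ->
  in_backbone N nm mis h = in_backbone N nm mis h'.
Proof.
by case/(eq_views N nm mis) => _ e3 e4; rewrite /in_backbone (eq_items N e3) (eq_items N e4).
Qed.

Lemma eq_leader N nm mis h h' : (forall j, j < 5 -> h j =i h' j) ->
  leader N nm mis h = leader N nm mis h'.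
Proof. by case/(eq_views N nm mis) => e0 _ _; rewrite /leader (eq_items N e0). Qed.

(** * The lossless exchange of messages *)

Section Ideal.
Variables (ph : phys) (G : network) (N : nat) (I : {set 'I_(nn G)}).
Hypothesis ok : phys_ok ph.
Hypothesis name_inj : injective (nname G).
Hypothesis name_le : forall x, nname G x <= N.
Hypothesis I_indep : independent ph G I.
Implicit Types x y z u w a : 'I_(nn G).

Definition near x y := (x == y) || adj ph G x y.

Lemma near_refl x : near x x. Proof. by rewrite /near eqxx. Qed.

Lemma near_sym x y : near x y = near y x.
Proof. by rewrite /near eq_sym adj_sym. Qed.

Lemma near_nd x y : near x y -> (nd G x y <= radius ph)%Re.
Proof.
case/orP => [/eqP ->|/adjP[] //]; rewrite nd_refl; have := radius_gt0 ok; lra.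
Qed.

(* The messages heard in each phase when every node hears all its neighbours. *)
Fixpoint ideal (k : nat) x (i : nat) : seq (seq nat) :=
  if k is k'.+1 then
    [seq content N (nname G y) (y \in I) (ideal k' y) i | y <- enum 'I_(nn G) & adj ph G x y]
  else [::].

Lemma idealS k x i : ideal k.+1 x i =
  [seq content N (nname G y) (y \in I) (ideal k y) i | y <- enum 'I_(nn G) & adj ph G x y].
Proof. by []. Qed.

(** [k] is mere recursion fuel: phase [i] consults earlier phases only, so any fuel above [i]
    suffices, and 5 is enough for all phases. *)
Lemma ideal_stable i k k' x : i < k -> i < k' -> ideal k x i = ideal k' x i.
Proof.
elim/ltn_ind: i k k' x => i IH [|k] [|k'] x // ik ik' /=.
apply: eq_map => y; apply: eq_content => j ji; rewrite (IH j ji k k') //; lia.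
Qed.

Definition hears x := ideal 5 x.
Definition says x i := content N (nname G x) (x \in I) (hears x) i.

Lemma hearsE x i : i < 5 -> hears x i = [seq says y i | y <- enum 'I_(nn G) & adj ph G x y].
Proof.
move=> i5; rewrite /hears idealS; apply: eq_map => y; apply: eq_content => j ji.
by rewrite (@ideal_stable j 4 5) //; lia.
Qed.

Lemma head_says x i : i < 5 -> head 0 (says x i) = nname G x.
Proof. by case: i => [|[|[|[|[|]]]]]. Qed.

Lemma mem_view x i l : i < 5 ->
  reflect (exists2 y, near x y & l = says y i) (l \in says x i :: hears x i).
Proof.
move=> i5; rewrite inE hearsE //; apply: (iffP orP).
  case=> [/eqP ->|/mapP[y]]; first by exists x; rewrite ?near_refl.
  by rewrite mem_filter => /andP[xy _] ->; exists y; rewrite // /near xy orbT.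
case=> y /orP[/eqP <-|xy] ->; first by left.
by right; apply/mapP; exists y; rewrite // mem_filter xy mem_enum.
Qed.

Lemma mem_items x i b : i < 5 ->
  reflect (b <= N /\ exists2 y, near x y & b \in behead (says y i))
    (b \in items N (says x i :: hears x i)).
Proof.
move=> i5; rewrite mem_filter mem_iota leq0n add0n ltnS andTb andbC.
apply: (iffP andP) => -[bN].
  by case/hasP => l /(mem_view _ _ i5)[y xy ->] bl; split=> //; exists y.
case=> y xy by_; split=> //; apply/hasP; exists (says y i) => //.
by apply/mem_view => //; exists y.
Qed.

Lemma witnessP x i b : i < 5 -> b \in items N (says x i :: hears x i) ->
  exists y, [/\ near x y, b \in behead (says y i) &
                witness N (says x i :: hears x i) b = nname G y].
Proof.
move=> i5 /(mem_items _ _ i5)[_ [y xy by_]].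
have vP l := mem_view x l i5; set V := _ :: _ in vP *; clearbody V; rewrite /witness.
set s := [seq _ <- _ | _].
have ys : nname G y \in s.
  rewrite mem_filter mem_iota leq0n add0n ltnS name_le !andbT; apply/hasP.
  exists (says y i); first by apply/vP; exists y.
  by rewrite head_says // eqxx.
have : head 0 s \in s by case: (s) ys => //= c s' _; rewrite inE eqxx.
rewrite mem_filter /= => /andP[/hasP[l /vP[y' xy' ->]]].
by rewrite head_says // => /andP[/eqP <- b'] _; exists y'.
Qed.

Lemma behead_says0 x b : b \in behead (says x 0) -> x \in I /\ b = nname G x.
Proof. by rewrite /says /content /=; case: (x \in I) => //=; rewrite inE => /eqP. Qed.

Lemma mem_says0 x : x \in I -> nname G x \in behead (says x 0).
Proof. by rewrite /says /content /= => ->; rewrite inE. Qed.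

Lemma says1 x : behead (says x 1) = items N (says x 0 :: hears x 0). Proof. by []. Qed.
Lemma says2 x : behead (says x 2) = items N (says x 1 :: hears x 1). Proof. by []. Qed.
Lemma says3 x : behead (says x 3) =
  let V := says x 2 :: hears x 2 in if x \in I then map (witness N V) (items N V) else [::].
Proof. by []. Qed.
Lemma says4 x : behead (says x 4) =
  let V := says x 1 :: hears x 1 in
  if nname G x \in items N (says x 3 :: hears x 3) then map (witness N V) (items N V) else [::].
Proof. by []. Qed.

(** Each phase carries the names of independent nodes one hop further, and a hop has length at most
    [radius ph]. *)
Lemma items_dominators i x b : i < 3 -> b \in items N (says x i :: hears x i) ->
  exists z, [/\ z \in I, b = nname G z & (nd G x z <= INR i.+1 * radius ph)%Re].
Proof.
elim: i x => [|i IH] x i3.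
  case/mem_items => // _ [y /near_nd xy /behead_says0[yI ->]].
  by exists y; split=> //=; rewrite Rmult_1_l.
case/mem_items => [|_ [y /near_nd xy]]; first lia.
have -> : behead (says y i.+1) = items N (says y i :: hears y i).
  by case: i i3 {IH} => [|[|]].
case/(IH _ (ltnW i3)) => z [zI -> yz].
exists z; split=> //; have := nd_triangle y x z; rewrite (S_INR i.+1); lra.
Qed.

End Ideal.

(** * The backbone *)

Lemma leq_card_bigcup (J T : finType) (P : pred J) (F : J -> {set T}) k :
  (forall i, P i -> #|F i| <= k) -> #|\bigcup_(i | P i) F i| <= #|P| * k.
Proof.
move=> hk; rewrite -sum_nat_const.
elim/big_rec2: _ => [|i s A /hk Fi IH]; first by rewrite cards0.
by apply: leq_trans (leq_card_setU _ _) _; apply: leq_add.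
Qed.

Section Paths.
Variables (ph : phys) (G : network) (A : {set 'I_(nn G)}).

Lemma reach_le k l x y : k <= l -> reach ph G A k x y -> reach ph G A l x y.
Proof. by move/subnK <-; elim: (l - k) => //= m IH /IH; left. Qed.

Lemma reach_trans k l y x z :
  reach ph G A k x y -> reach ph G A l y z -> reach ph G A (k + l) x z.
Proof.
move=> xy; elim: l z => [|l IH] z; first by rewrite addn0 => <-.
rewrite addnS => -[/IH|[w [/IH xw h]]]; first by left.
by right; exists w.
Qed.

Lemma reach_near x y : x \in A -> y \in A -> near ph x y -> reach ph G A 1 x y.
Proof.
move=> xA yA /orP[/eqP ->|xy]; first by left.
by right; exists x.
Qed.

End Paths.

Lemma path_reach ph G (x : 'I_(nn G)) p : path (adj ph G) x p ->
  reach ph G [set: 'I_(nn G)] (size p) x (last x p).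
Proof.
elim/last_ind: p => // p y IH; rewrite rcons_path last_rcons size_rcons => /andP[/IH h e].
by right; exists (last x p); rewrite !inE.
Qed.

Section Structure.
Variables (ph : phys) (G : network) (N : nat) (I : {set 'I_(nn G)}).
Hypothesis ok : phys_ok ph.
Hypothesis name_inj : injective (nname G).
Hypothesis name_le : forall x, nname G x <= N.
Hypothesis I_max : maximal_independent ph G I.
Variable q : nat.
Hypothesis crowd : forall y, #|[set w in I | Rleb (nd G w y) (INR 3 * radius ph)]| <= q.
Implicit Types x y z u w a v : 'I_(nn G).

Notation says := (says ph N I).
Notation hears := (hears ph N I).
Notation near := (near ph).

Definition member x := in_backbone N (nname G x) (x \in I) (hears x).
Definition lead x := leader N (nname G x) (x \in I) (hears x).

Lemma crowd_le k y : k <= 3 -> #|[set w in I | Rleb (nd G w y) (INR k * radius ph)]| <= q.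
Proof.
move=> k3; apply: leq_trans (crowd y); apply: subset_leq_card; apply/subsetP => w.
rewrite !inE => /andP[-> /RlebP le]; apply/RlebP; apply: Rle_trans le _.
apply: Rmult_le_compat_r; first exact/Rlt_le/radius_gt0.
exact/le_INR/leP.
Qed.

Lemma card_named (l : seq nat) : #|[set x | nname G x \in l]| <= size l.
Proof.
rewrite cardE -(size_map (nname G)); apply: uniq_leq_size.
  by rewrite map_inj_uniq ?enum_uniq.
by move=> b /mapP[x]; rewrite mem_enum inE => xl ->.
Qed.

Lemma size_items x i : i < 3 -> size (items N (says x i :: hears x i)) <= q.
Proof.
move=> i3; apply: leq_trans (crowd_le x i3); rewrite [leqRHS]cardE -(size_map (nname G)).
apply: uniq_leq_size; first exact: filter_uniq (iota_uniq _ _).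
move=> b /(items_dominators ok i3)[z [zI -> xz]]; apply: map_f.
by rewrite mem_enum inE zI nd_sym; apply/RlebP.
Qed.

Lemma size_behead_says x i : 0 < i < 5 -> size (behead (says x i)) <= q.
Proof.
case: i => [|[|[|[|[|]]]]] // _; rewrite ?says1 ?says2 ?says3 ?says4 /=.
- exact: size_items.
- exact: size_items.
- by case: ifP => // _; rewrite size_map; apply: size_items.
- by case: ifP => // _; rewrite size_map; apply: size_items.
Qed.

(** Bounds a message by constantly many names, that is, by O(log N) bits: all lists come from
    independent nodes within three hops, of which there are at most [q]. *)
Lemma size_says x i : i < 5 -> size (says x i) <= q.+2.
Proof.
case: i => [|i] i5; first by rewrite /= size_nseq; case: (x \in I).
by have := @size_behead_says x i.+1 i5; rewrite size_behead; lia.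
Qed.

Lemma items_le V : all (leq^~ N) (items N V).
Proof. by apply/allP => b; rewrite mem_filter mem_iota => /andP[_]; lia. Qed.

Lemma witnesses_le x i : i < 5 -> let V := says x i :: hears x i in
  all (leq^~ N) (map (witness N V) (items N V)).
Proof.
move=> i5 /=; apply/allP => _ /mapP[b bV ->].
by have [y [_ _ ->]] := witnessP name_le i5 bV; apply: name_le.
Qed.

Lemma says_le x i : i < 5 -> all (leq^~ N) (says x i).
Proof.
move=> i5; suff tail : all (leq^~ N) (behead (says x i)).
  have -> : says x i = nname G x :: behead (says x i).
    by rewrite -(head_says ph N I x i5); case: i i5 {tail} => [|[|[|[|[|]]]]].
  by move: tail => /= ->; rewrite name_le.
case: i i5 => [|[|[|[|[|]]]]] // _.
- by apply/allP => b /behead_says0[_ ->]; apply: name_le.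
- exact: items_le.
- exact: items_le.
- by rewrite says3 /=; case: ifP => // _; apply: witnesses_le.
- by rewrite says4 /=; case: ifP => // _; apply: witnesses_le.
Qed.

Lemma memberE x : member x =
  [|| x \in I, nname G x \in items N (says x 3 :: hears x 3)
    | nname G x \in items N (says x 4 :: hears x 4)].
Proof. by []. Qed.

(** Charges the backbone to the independent set: [a], the first inner vertices it nominates, and all
    nodes that these nominate in turn. *)
Definition recruits a : {set 'I_(nn G)} :=
  a |: ([set x | nname G x \in behead (says a 3)] :|:
    \bigcup_(u in [set u | nname G u \in behead (says a 3)])
      [set x | nname G x \in behead (says u 4)]).

Lemma card_recruits a : #|recruits a| <= (q * q + q).+1.
Proof.
have s3 : size (behead (says a 3)) <= q by apply: size_behead_says.
apply: leq_trans (leq_card_setU _ _) _; rewrite cards1 ltnS addnC.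
apply: leq_trans (leq_card_setU _ _) _; apply: leq_add.
  exact: leq_trans (card_named _) s3.
apply: leq_trans (leq_card_bigcup (k := q) _) _.
  by move=> u _; apply: leq_trans (card_named _) (size_behead_says _ _).
by rewrite leq_mul2r (leq_trans _ s3) ?orbT ?card_named.
Qed.

Lemma member_recruits x : member x -> exists a,
  [/\ a \in I, x \in recruits a & (nd G a x <= 2 * radius ph)%Re].
Proof.
have r0 := radius_gt0 ok.
have behead3 a b : b \in behead (says a 3) -> a \in I by rewrite says3 /=; case: ifP.
rewrite memberE => /or3P[xI|/mem_items[//|_ [a xa xs]]|/mem_items[//|_ [u xu xs]]].
- by exists x; rewrite nd_refl !inE eqxx; split=> //; lra.
- exists a; rewrite (behead3 _ _ xs) !inE xs !orbT; split=> //.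
  by have := near_nd ok xa; rewrite nd_sym; lra.
- have : nname G u \in items N (says u 3 :: hears u 3).
    by move: xs; rewrite says4 /=; case: ifP.
  case/mem_items => // _ [a ua us]; exists a; split; first exact: behead3 us.
    rewrite !inE; apply/orP; right; apply/orP; right.
    by apply/bigcupP; exists u; rewrite inE.
  have := near_nd ok xu; have := near_nd ok ua; have := nd_triangle u a x.
  by rewrite (nd_sym x u) (nd_sym u a); lra.
Qed.

(** A member near [y] is recruited by an independent node at most two hops away from it, hence
    within three radii of [y], where [crowd] applies. *)
Lemma member_dense y :
  #|[set x | member x && Rleb (nd G y x) (radius ph)]| <= q * (q * q + q).+1.
Proof.
set B := [set a in I | Rleb (nd G a y) (INR 3 * radius ph)].
apply: (@leq_trans #|\bigcup_(a in B) recruits a|).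
  apply: subset_leq_card; apply/subsetP => x; rewrite inE => /andP[/member_recruits].
  case=> a [aI xa ax] /RlebP yx; apply/bigcupP; exists a => //; rewrite inE aI.
  apply/RlebP; have := nd_triangle x a y; rewrite (nd_sym x y) /=; lra.
apply: leq_trans (leq_card_bigcup _) _; first by move=> a _; apply: card_recruits.
by rewrite leq_mul2r crowd orbT.
Qed.

(** The independent set mediates: each node of [A] has at most [q] independent nodes within one hop,
    these exhaust [I] by domination, and each of them recruits boundedly many members. *)
Lemma card_member A : is_cds ph G A -> #|[set x | member x]| <= q * (q * q + q).+1 * #|A|.
Proof.
case=> _ [dom _].
have cI : #|I| <= #|A| * q.
  apply: (@leq_trans #|\bigcup_(v in A) [set a in I | Rleb (nd G a v) (INR 1 * radius ph)]|).
    apply: subset_leq_card; apply/subsetP => a aI.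
    have [v vA av] : exists2 v, v \in A & near a v.
      case: (dom a) => [aA|[v [vA av]]]; first by exists a; rewrite ?near_refl.
      by exists v => //; apply/orP; right.
    apply/bigcupP; exists v => //; rewrite inE aI; apply/RlebP.
    by have := near_nd ok av; rewrite /=; lra.
  by apply: leq_card_bigcup => v _; apply: crowd_le.
apply: (@leq_trans #|\bigcup_(a in I) recruits a|).
  apply: subset_leq_card; apply/subsetP => x; rewrite inE => /member_recruits[a [aI xa _]].
  by apply/bigcupP; exists a.
apply: leq_trans (leq_card_bigcup _) _; first by move=> a _; apply: card_recruits.
by rewrite -mulnA (mulnC _ #|A|) mulnA (mulnC q) leq_mul2r cI orbT.
Qed.

(** The name of [b] travels back along the given path, so [a] learns it by phase 2. The nominated
    path may be another one: [u] is some node that announced [b] in phase 2, and [w] some node that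
    announced it to [u] in phase 1. As [near] is reflexive, shorter paths are covered too. *)
Lemma member_link a b x y : a \in I -> b \in I -> near a x -> near x y -> near y b ->
  exists u w, [/\ member u, member w, near a u, near u w & near w b].
Proof.
move=> aI bI ax xy yb.
have b1 : nname G b \in behead (says y 1).
  by apply/mem_items => //; split=> //; exists b => //; apply: mem_says0.
have b2 : nname G b \in behead (says x 2) by apply/mem_items => //; split=> //; exists y.
have b3 : nname G b \in items N (says a 2 :: hears a 2).
  by apply/mem_items => //; split=> //; exists x.
have [u [au bu pu]] := witnessP name_le (isT : 2 < 5) b3.
have us : nname G u \in behead (says a 3).
  by rewrite says3 /= aI -pu; apply: map_f.
have u3 : nname G u \in items N (says u 3 :: hears u 3).
  by apply/mem_items => //; split=> //; exists a; rewrite // near_sym.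
rewrite says2 in bu.
have [w [uw bw pw]] := witnessP name_le (isT : 1 < 5) bu.
have ws : nname G w \in behead (says u 4).
  by rewrite says4 /= u3 -pw; apply: map_f.
have [_ [z wz /behead_says0[zI /name_inj e]]] := elimT (mem_items ph N I w _ (isT : 0 < 5)) bw.
exists u, w; rewrite !memberE u3 orbT; split=> //; last by rewrite e.
apply/or3P/Or33/mem_items => //; split=> //.
by exists u; rewrite // near_sym.
Qed.

Lemma dominated x : exists2 a, a \in I & near x a.
Proof.
have [xI|/(proj2 I_max)[a [aI xa]]] := boolP (x \in I); first by exists x; rewrite // near_refl.
by exists a => //; apply/orP; right.
Qed.

Lemma member_I a : a \in I -> member a.
Proof. by rewrite memberE => ->. Qed.

(** Every vertex of the path is replaced by an independent node near it; consecutive ones are joined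
    by [member_link] in three steps. One further link is paid because the dominators chosen at an
    end may differ. *)
Lemma member_reach k x y a b : reach ph G [set: 'I_(nn G)] k x y ->
  a \in I -> b \in I -> near x a -> near y b ->
  reach ph G [set z | member z] (3 * k.+1) a b.
Proof.
have link a' b' x' y' : a' \in I -> b' \in I -> near a' x' -> near x' y' -> near y' b' ->
    reach ph G [set z | member z] 3 a' b'.
  move=> aI bI ax xy yb; have [u [w [mu mw au uw wb]]] := member_link aI bI ax xy yb.
  have step s t : member s -> member t -> near s t -> reach ph G [set z | member z] 1 s t.
    by move=> ms mt; apply: reach_near; rewrite inE.
  apply: (reach_trans (k := 1) (step _ _ (member_I aI) mu au)).
  apply: (reach_trans (k := 1) (step _ _ mu mw uw)).
  exact: step mw (member_I bI) wb.
elim: k y b => [|k IH] y b.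
  move=> <- aI bI xa xb; rewrite muln1.
  by apply: (link _ _ x x) => //; rewrite ?near_refl // near_sym.
case=> [xy aI bI xa yb|[z [xz [_ [_ zy]]]] aI bI xa yb].
  by apply: (reach_le _ (IH _ _ xy aI bI xa yb)); rewrite leq_mul2l ltnW.
have [c cI zc] := dominated z.
rewrite mulnS addnC; apply: (reach_trans (IH _ _ xz aI cI xa zc)).
by apply: (link _ _ z y) => //; [rewrite near_sym|apply/orP; right].
Qed.

(** Of the additive 5, three come from [member_reach] and two from the steps joining [x] and [y] to
    their dominators. *)
Lemma member_diam k x y : reach ph G [set: 'I_(nn G)] k x y -> member x -> member y ->
  reach ph G [set z | member z] (3 * k + 5) x y.
Proof.
move=> xy mx my; have [a aI xa] := dominated x; have [b bI yb] := dominated y.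
have ab := member_reach xy aI bI xa yb.
rewrite (_ : 3 * k + 5 = 1 + (3 * k.+1 + 1)); last by lia.
have inM z : member z -> z \in [set z | member z] by rewrite inE.
have xa1 := reach_near (inM _ mx) (inM _ (member_I aI)) xa.
have by1 : reach ph G [set z | member z] 1 b y.
  by apply: reach_near; [exact/inM/member_I|exact: inM|rewrite near_sym].
exact: reach_trans xa1 (reach_trans ab by1).
Qed.

Lemma lead_adj w : ~~ member w -> exists v, [/\ v \in I, adj ph G w v & lead w = nname G v].
Proof.
move=> mw; have [a aI wa] := dominated w.
have a0 : nname G a \in items N (says w 0 :: hears w 0).
  by apply/mem_items => //; split=> //; exists a => //; apply: mem_says0.
have : lead w \in items N (says w 0 :: hears w 0).
  rewrite /lead /leader; change (view0 _ _ _) with (says w 0 :: hears w 0).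
  by case: items a0 => //= b s _; rewrite inE eqxx.
case/mem_items => // _ [v wv /behead_says0[vI e]]; exists v; split=> //.
case/orP: wv => // /eqP wv; by rewrite wv member_I in mw.
Qed.

Lemma backbone_member o c : 0 < nn G -> graph_connected ph G ->
  (forall x, o_inH (o x) = member x) -> (forall x, o_leader (o x) = lead x) ->
  8 <= c -> q * (q * q + q).+1 <= c -> backbone ph G c o.
Proof.
move=> n0 conn oH oL c8 cq.
have HE : Hset G o = [set x | member x] by apply/setP => x; rewrite !inE oH.
have [a0 a0I _] := dominated (Ordinal n0).
rewrite /backbone /leader_of HE; split; [|split; [|split; [|split]]].
- split; [|split].
  + by exists a0; rewrite inE member_I.
  + move=> x; have [a aI /orP[/eqP ->|xa]] := dominated x; first by left; rewrite inE member_I.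
    by right; exists a; rewrite inE member_I.
  + move=> x y; rewrite !inE => mx my; have /connectP[p pp e] := conn x y.
    exists (3 * size p + 5); apply: member_diam => //.
    by rewrite e; apply: path_reach.
- by move=> A /card_member h; apply: leq_trans h _; rewrite leq_mul2r cq orbT.
- move=> k dk x y; rewrite !inE => mx my.
  have := dk x y; rewrite !inE => /(_ isT isT) xy.
  (* For [k = 0] the two nodes coincide; otherwise [3 * k + 5 <= 8 * k], whence the requirement
     [8 <= c]. *)
  case: k {dk} xy => [-> //|k xy]; first by rewrite muln0.
  apply: reach_le (member_diam xy mx my); apply: (@leq_trans (8 * k.+1)); first lia.
  by rewrite leq_mul2r c8 orbT.
- move=> x; apply: leq_trans cq; apply: leq_trans (member_dense x).
  apply: subset_leq_card; apply/subsetP => y; rewrite !inE => /andP[-> /adjP[_ le]].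
  exact/RlebP.
- move=> w; rewrite inE => /lead_adj[v [vI wv e]].
  exists v; rewrite inE member_I // oL; split=> //; split=> // v' _ [_].
  by rewrite e => /name_inj.
Qed.

End Structure.

(** * Execution of the algorithm *)

Lemma eq_rcv ph G tx tx' (u y : 'I_(nn G)) : tx =1 tx' -> rcv ph G tx u y = rcv ph G tx' u y.
Proof.
move=> e; rewrite /rcv !e !rsumE.
by rewrite (eq_bigl (fun w => tx' w && (w != u))) // => w; rewrite e.
Qed.

(** The whole history is kept: replays need the old coins, and relays need the rounds of
    reception. *)
Record memory := Memory { own_name : nat; own_mis : bool; log : seq (nat * seq msg) }.

Section Program.
(* Words of length [b] encode names and messages are truncated to [cap] bits;
   there are five phases of [T1] rounds, in which nodes repeatedly use the
   transmission pattern given by the first [T1] coins ([coin < z1]), followed by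
   [T2] rounds in which backbone nodes with [coin < z2] announce themselves. *)
Variables (N b cap T1 T2 z1 z2 : nat).

Definition coin_at (s : memory) (t : nat) : nat := nth 0 (map fst (log s)) t.

Definition heard_in (s : memory) (i : nat) : seq (seq nat) :=
  [seq decode b m | m <- flatten (map snd (take T1 (drop (i * T1) (log s))))].

Definition joined (s : memory) : bool :=
  in_backbone N (own_name s) (own_mis s) (heard_in s).

(** With the current coin [k] appended, entry [t %% T1] is the fresh coin during phase 0 and a
    replayed one in the later phases. *)
Definition send (t : nat) (s : memory) (k : nat) : option msg :=
  if t < 5 * T1 then
    if nth 0 (rcons (map fst (log s)) k) (t %% T1) < z1 then
      Some (take cap (encode b (content N (own_name s) (own_mis s) (heard_in s) (t %/ T1))))
    else None
  else if joined s && (k < z2) then Some (take cap (encode b [:: own_name s])) else None.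

Definition announced (nm : nat) (p : nat * seq msg) : bool :=
  [:: nm] \in map (decode b) p.2.

(* A relay has to name the round in which it received the relayed message. *)
Definition slots (s : memory) : seq nat :=
  [seq find (announced nm) (drop (5 * T1) (log s)) |
     nm <- iota 0 N.+1 & has (announced nm) (drop (5 * T1) (log s))].

(** Block 0 of [T2] rounds repeats the announcement rounds with own messages; in block [j.+1] each
    node relays what it received in its [j]-th slot of block 0. *)
Definition inter_schedule (s : memory) (t : nat) : act :=
  if joined s && (coin_at s (5 * T1 + t %% T2) < z2) then
    if t %/ T2 is j.+1 then
      if j < size (slots s) then Relay (nth 0 (slots s) j) else Listen
    else Own
  else Listen.

Definition intra_schedule (s : memory) (t : nat) : act :=
  if coin_at s t < z1 then Own else Listen.

Definition result (s : memory) : output :=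
  Output (joined s) (leader N (own_name s) (own_mis s) (heard_in s))
    (inter_schedule s) (intra_schedule s).

End Program.

Section Execution.
Variables (wordlen msgcap len1 len2 thr1 thr2 K : nat -> nat -> nat).

Definition connectbb : algorithm memory := {|
  al_T N D := 5 * len1 N D + len2 N D;
  al_K := K;
  al_init N D nm mis := Memory nm mis [::];
  al_send N D := send N (wordlen N D) (msgcap N D) (len1 N D) (thr1 N D) (thr2 N D);
  al_upd N D t s k _ ms := Memory (own_name s) (own_mis s) (rcons (log s) (k, ms));
  al_out N D := result N (wordlen N D) (len1 N D) (len2 N D) (thr1 N D) (thr2 N D) |}.

Variables (ph : phys) (G : network) (N D : nat) (I : {set 'I_(nn G)}).
Hypothesis ok : phys_ok ph.
Hypothesis name_inj : injective (nname G).
Hypothesis name_le : forall x, nname G x <= N.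
Hypothesis I_max : maximal_independent ph G I.
Variable q : nat.
Hypothesis crowd : forall y, #|[set w in I | Rleb (nd G w y) (INR 3 * radius ph)]| <= q.
Hypothesis b_gt0 : 0 < wordlen N D.
Hypothesis N_lt : forall k, k <= N -> k < 2 ^ wordlen N D.
Hypothesis cap_ge : q.+2 * wordlen N D <= msgcap N D.
Hypothesis T1_gt0 : 0 < len1 N D.
Variable w : tape memory connectbb G N D.
Implicit Types x y u v : 'I_(nn G).

Notation b := (wordlen N D).
Notation cap := (msgcap N D).
Notation T1 := (len1 N D).
Notation T2 := (len2 N D).
Notation z1 := (thr1 N D).
Notation z2 := (thr2 N D).
Notation coin := (coin memory connectbb G N D w).
Notation st := (state memory connectbb ph G N D I w).
Notation sent := (fun t => sends memory connectbb G N D w t (st t)).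
Notation hd := (fun t => heard memory connectbb ph G N D w t (st t)).
Notation member := (member ph N I).

Definition on1 (s : nat) x : bool := coin x s < z1.
Definition on2 (s : nat) x : bool := member x && (coin x (5 * T1 + s) < z2).

Lemma stE t x : st t x =
  Memory (nname G x) (x \in I) (mkseq (fun i => (coin x i, hd i x)) t).
Proof. by elim: t => //= t ->; rewrite mkseqS. Qed.

Lemma log_st t x : log (st t x) = mkseq (fun i => (coin x i, hd i x)) t.
Proof. by rewrite stE. Qed.

Lemma coins_st t x : map fst (log (st t x)) = mkseq (coin x) t.
Proof. by rewrite log_st /mkseq -map_comp. Qed.

Lemma hdP t y m :
  reflect (exists2 u, rcv ph G (fun z => isSome (sent t z)) u y & sent t u = Some m)
    (m \in hd t y).
Proof.
rewrite /heard mem_pmap; apply: (iffP mapP) => [[u _]|[u ru su]].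
  by case: ifP => // ru e; exists u.
by exists u; rewrite ?mem_enum // ru.
Qed.

Lemma sent_phase t x : t < 5 * T1 -> sent t x =
  if on1 (t %% T1) x then
    Some (take cap (encode b (content N (nname G x) (x \in I) (heard_in b T1 (st t x)) (t %/ T1))))
  else None.
Proof.
move=> tT; rewrite /sends /= /send tT coins_st -mkseqS nth_mkseq ?ltnS ?leq_mod //.
by rewrite [own_name _](congr1 own_name (stE t x)) [own_mis _](congr1 own_mis (stE t x)).
Qed.

Lemma heard_in_st i t x l : i.+1 * T1 <= t ->
  reflect (exists s m, [/\ s < T1, m \in hd (i * T1 + s) x & l = decode b m])
    (l \in heard_in b T1 (st t x) i).
Proof.
move=> it; rewrite /heard_in log_st /mkseq -map_drop -map_take drop_iota take_iota add0n.
rewrite (minn_idPl _); last by rewrite mulSn in it; lia.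
rewrite -map_comp; apply: (iffP mapP).
  case=> m /flatten_mapP[j]; rewrite mem_iota => js mj ->; exists (j - i * T1), m.
  by rewrite subnKC; [split=> //; lia|lia].
case=> s [m [sT ms ->]]; exists m => //; apply/flatten_mapP; exists (i * T1 + s) => //.
by rewrite mem_iota; lia.
Qed.

(** This event and [member_heard] are all that is asked of the coins; given them, the analysis of
    the execution is deterministic. *)
Hypothesis all_heard : forall u y, adj ph G u y ->
  exists2 s, s < T1 & rcv ph G (on1 s) u y.

Lemma encode_says x i : i < 5 ->
  decode b (take cap (encode b (says ph N I x i))) = says ph N I x i.
Proof.
move=> i5; have bd : all (fun n => n < 2 ^ b) (says ph N I x i).
  by apply/allP => k /(allP (says_le ph I name_le x i5)); apply: N_lt.
rewrite take_oversize ?encodeK // size_encode // (leq_trans _ cap_ge) // leq_mul2r.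
by rewrite (size_says N ok crowd x i5) orbT.
Qed.

(** Induction on the phase: every phase has the transmission pattern [on1], hence the same
    receptions, and by [eq_content] its messages are those of the lossless exchange. *)
Lemma phase_hears i t x : i < 5 -> i.+1 * T1 <= t ->
  heard_in b T1 (st t x) i =i hears ph N I x i.
Proof.
elim/ltn_ind: i t x => i IH t x i5 it l.
have div s : s < T1 -> ((i * T1 + s) %/ T1 = i) * ((i * T1 + s) %% T1 = s).
  by move=> sT; rewrite divnMDl // divn_small // addn0 modnMDl modn_small.
have sentE s u : s < T1 -> sent (i * T1 + s) u =
    if on1 s u then Some (take cap (encode b (says ph N I u i))) else None.
  move=> sT; rewrite sent_phase; last first.
    by apply: (@leq_trans (i.+1 * T1)); rewrite ?leq_mul2r ?i5 ?orbT // mulSn; lia.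
  rewrite !(div _ sT); congr (if _ then Some (take _ (encode _ _)) else _).
  apply: eq_content => j ji; apply: IH => //; first lia.
  by apply: (@leq_trans (i * T1)); rewrite ?leq_addr // leq_mul2r ji orbT.
have txE s : s < T1 -> (fun z => isSome (sent (i * T1 + s) z)) =1 on1 s.
  by move=> sT z; rewrite sentE //; case: (on1 s z).
rewrite hearsE //; apply/heard_in_st/mapP => //.
  case=> s [m [sT /hdP[u ru]]]; rewrite sentE //; case: ifP => // _ [<-] ->.
  exists u; last exact: encode_says.
  by rewrite mem_filter mem_enum adj_sym (rcv_adj ru).
case=> u; rewrite mem_filter adj_sym => /andP[ux _] ->.
have [s sT ru] := all_heard ux.
exists s, (take cap (encode b (says ph N I u i))); rewrite encode_says //; split=> //.
apply/hdP; exists u; first by rewrite (eq_rcv _ _ _ (txE s sT)).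
by rewrite sentE //; case/and4P: ru => ->.
Qed.

Lemma joinedE t x : 5 * T1 <= t -> joined N b T1 (st t x) = member x.
Proof.
move=> tT; rewrite /joined stE /= -stE; apply: eq_in_backbone => j j5.
by apply: phase_hears => //; apply: leq_trans tT; rewrite leq_mul2r j5 orbT.
Qed.

Lemma sent_announce s x : sent (5 * T1 + s) x =
  if on2 s x then Some (take cap (encode b [:: nname G x])) else None.
Proof.
rewrite /sends /= /send ltnNge leq_addr /= joinedE ?leq_addr // stE /=.
by rewrite /on2; case: (member x).
Qed.

Notation fin := (st (5 * T1 + T2)).

Lemma announcedP s v nm : s < T2 ->
  reflect (exists2 u, rcv ph G (on2 s) u v & nm = nname G u)
    (announced b nm (coin v (5 * T1 + s), hd (5 * T1 + s) v)).
Proof.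
move=> sT; have txE : (fun z => isSome (sent (5 * T1 + s) z)) =1 on2 s.
  by move=> z; rewrite sent_announce; case: (on2 s z).
have name_code u : decode b (take cap (encode b [:: nname G u])) = [:: nname G u].
  have bd : all (fun n => n < 2 ^ b) [:: nname G u] by rewrite /= N_lt.
  by rewrite take_oversize ?encodeK // size_encode //; apply: leq_trans cap_ge; rewrite leq_mul2r orbT.
apply: (iffP mapP) => /= [[m /hdP[u ru]]|[u ru ->]].
  rewrite sent_announce; case: ifP => // _ [<-]; rewrite name_code => -[->].
  by exists u => //; rewrite -(eq_rcv _ _ _ txE).
exists (take cap (encode b [:: nname G u])); last by rewrite name_code.
apply/hdP; exists u; first by rewrite (eq_rcv _ _ _ txE).
by rewrite sent_announce; case/and4P: ru => ->.
Qed.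

Lemma drop_fin v : drop (5 * T1) (log (fin v)) =
  mkseq (fun s => (coin v (5 * T1 + s), hd (5 * T1 + s) v)) T2.
Proof.
rewrite log_st /mkseq -map_drop drop_iota add0n addKn -[X in iota X _]addn0 iotaDl.
by rewrite -map_comp.
Qed.

Lemma has_announced v nm :
  reflect (exists s u, [/\ s < T2, rcv ph G (on2 s) u v & nm = nname G u])
    (has (announced b nm) (drop (5 * T1) (log (fin v)))).
Proof.
rewrite drop_fin; apply: (iffP hasP) => [[_ /mapP[s] + ->]|[s [u [sT ru e]]]].
  by rewrite mem_iota => sT /(announcedP _ _ sT)[u ru e]; exists s, u.
exists (coin v (5 * T1 + s), hd (5 * T1 + s) v).
  by apply/mapP; exists s => //; rewrite mem_iota.
by apply/announcedP => //; exists u.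
Qed.

Lemma size_slots v : size (slots N b T1 (fin v)) <= q * (q * q + q).+1.
Proof.
apply: leq_trans (member_dense N ok name_inj crowd v).
rewrite size_map [leqRHS]cardE -(size_map (nname G)); apply: uniq_leq_size.
  exact: filter_uniq (iota_uniq _ _).
move=> nm; rewrite mem_filter => /andP[/has_announced[s [u [_ ru ->]]] _]; apply: map_f.
rewrite mem_enum inE; case/and4P: (ru) => /andP[-> _] _ _ _ /=.
by apply/RlebP; rewrite nd_sym; case/adjP: (rcv_adj ru).
Qed.

(** The slot is the first round in which [v] hears the name of [u]; as names are injective, the node
    received in that round is [u] itself. *)
Lemma slots_heard u v s : s < T2 -> rcv ph G (on2 s) u v ->
  exists j, [/\ j < size (slots N b T1 (fin v)), nth 0 (slots N b T1 (fin v)) j < T2 &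
    rcv ph G (on2 (nth 0 (slots N b T1 (fin v)) j)) u v].
Proof.
move=> sT ru; set L := [seq nm <- iota 0 N.+1 | has (announced b nm) (drop (5 * T1) (log (fin v)))].
have hu : has (announced b (nname G u)) (drop (5 * T1) (log (fin v))).
  by apply/has_announced; exists s, u.
have uL : nname G u \in L by rewrite mem_filter hu mem_iota ltnS name_le.
exists (index (nname G u) L); rewrite (nth_map 0) ?index_mem // nth_index //.
rewrite size_map index_mem; have := hu; rewrite has_find.
have := nth_find (0, [::]) hu; set f := find _ _.
rewrite drop_fin size_mkseq => + fT; rewrite nth_mkseq // => /(announcedP _ _ fT)[u' ru'].
by move/name_inj => e; split=> //; rewrite e.
Qed.

Hypothesis member_heard : forall u y, member u -> adj ph G u y ->
  exists2 s, s < T2 & rcv ph G (on2 s) u y.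

Definition outcome x := final_output memory connectbb ph G N D I w x.

Lemma outcomeE x : outcome x = result N b T1 T2 z1 z2 (fin x).
Proof. by []. Qed.

Lemma coin_fin x t : t < 5 * T1 + T2 -> coin_at (fin x) t = coin x t.
Proof. by move=> tT; rewrite /coin_at coins_st nth_mkseq. Qed.

Lemma outcome_inH x : o_inH (outcome x) = member x.
Proof. by rewrite outcomeE /= joinedE ?leq_addr. Qed.

Lemma outcome_leader x : o_leader (outcome x) = lead ph N I x.
Proof.
rewrite outcomeE /= stE /= -stE; apply: eq_leader => j j5.
apply: phase_hears => //; apply: (@leq_trans (5 * T1)); last exact: leq_addr.
by rewrite leq_mul2r j5 orbT.
Qed.

Lemma Hset_outcome x : (x \in Hset G outcome) = member x.
Proof. by rewrite inE outcome_inH. Qed.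

Lemma leader_outcome y v : y \notin Hset G outcome -> leader_of G outcome y v -> adj ph G y v.
Proof.
rewrite Hset_outcome => my [_]; rewrite outcome_leader.
by have [v' [_ yv' ->]] := lead_adj name_le I_max my; move/name_inj => <-.
Qed.

Lemma intra_outcome : intra_ok ph G outcome T1.
Proof.
move=> y v yH yv; have [s sT ru] := all_heard (leader_outcome yH yv).
have schE x : o_intra (outcome x) s = if on1 s x then Own else Listen.
  by rewrite outcomeE /= /intra_schedule coin_fin //; lia.
exists s, y; split=> //; split.
  by rewrite (eq_rcv _ _ _ (tx' := on1 s)) // => x; rewrite /sch_tx schE; case: (on1 s x).
by apply: carries_own; rewrite schE; case/and4P: ru => ->.
Qed.

(** The length is one block for own messages and one for each of the at most [q * (q * q + q).+1]
    slots. *)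
Lemma inter_outcome : inter_ok ph G outcome ((q * (q * q + q).+1).+1 * T2).
Proof.
rewrite /inter_ok; set sch := fun z => _; move=> u v; rewrite !Hset_outcome => mu mv uv.
have inter0 s x : s < T2 -> sch x s = if on2 s x then Own else Listen.
  move=> sT; rewrite /sch outcomeE /= /inter_schedule joinedE ?leq_addr //.
  by rewrite modn_small // divn_small // coin_fin ?ltn_add2l.
have tx0 s : s < T2 -> sch_tx G sch s =1 on2 s.
  by move=> sT x; rewrite /sch_tx inter0 //; case: (on2 s x).
have [s sT ru] := member_heard mu uv.
have [j [jS tT rt]] := slots_heard sT ru; set t := nth _ _ _ in tT rt.
have own_u : carries ph G sch u t u.
  by apply: carries_own; rewrite inter0 //; case/and4P: rt => ->.
split.
  exists t, u; split; first by apply: leq_trans tT _; rewrite mulSn leq_addr.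
  by split=> //; rewrite (eq_rcv _ _ _ (tx0 t tT)).
move=> y yH yv; have := leader_outcome yH yv; rewrite adj_sym => vy.
have [s' sT' rv] := member_heard mv vy.
(* In block [j.+1] node [v] relays the message of [u], and [s'] is a round of the pattern in which
   [y] receives [v]. *)
pose t' := j.+1 * T2 + s'.
have divE : (t' %/ T2 = j.+1) * (t' %% T2 = s').
  by rewrite /t' divnMDl ?divn_small ?addn0 ?modnMDl ?modn_small //; lia.
have interE x : sch x t' = if on2 s' x then
    (if j < size (slots N b T1 (fin x)) then Relay (nth 0 (slots N b T1 (fin x)) j) else Listen)
    else Listen.
  rewrite /sch outcomeE /= /inter_schedule joinedE ?leq_addr //.
  by rewrite !divE coin_fin ?ltn_add2l.
have von : on2 s' v by case/and4P: rv.
exists t', v; split.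
  apply: (@leq_trans (j.+2 * T2)); first by rewrite /t' (mulSn j.+1); lia.
  by rewrite leq_mul2r ltnS (leq_trans jS (size_slots v)) orbT.
split.
  (* Nodes with too few slots listen in this block, so the transmitters are only a subset of
     [on2 s']. *)
  apply: (rcv_sub ok _ _ rv) => [x|]; last by rewrite /sch_tx interE von jS.
  by rewrite /sch_tx interE; case: (on2 s' x).
apply: (carries_relay _ _ _ _ _ t _ _ _ _ _ own_u).
- by rewrite interE von jS.
- by apply: leq_trans tT _; rewrite /t' mulSn; lia.
- by rewrite (eq_rcv _ _ _ (tx0 t tT)).
Qed.

Lemma outcome_success c : 0 < nn G -> graph_connected ph G ->
  8 <= c -> q * (q * q + q).+1 <= c ->
  (q * (q * q + q).+1).+1 * T2 <= c * log2N N -> T1 <= c * D.+1 * log2N N ->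
  connectbb_success ph G N D c outcome.
Proof.
move=> n0 conn c8 cq cT2 cT1; split; last split.
- by apply: (backbone_member ok name_inj name_le I_max crowd) => // x;
    [apply: outcome_inH|apply: outcome_leader].
- by exists ((q * (q * q + q).+1).+1 * T2); split=> //; apply: inter_outcome.
- by exists T1; split=> //; apply: intra_outcome.
Qed.

End Execution.

(** * Union bound, choice of constants and the final probability estimate *)

Lemma card_bigcup_Rle (J T : finType) (P : pred J) (F : J -> {set T}) (k : R) :
  (forall i, P i -> (INR #|F i| <= k)%Re) ->
  (INR #|\bigcup_(i | P i) F i| <= INR #|P| * k)%Re.
Proof.
move=> hk; rewrite -rsum_const.
elim/big_rec2: _ => [|i s A /hk Fi IH]; first by rewrite cards0 /=; lra.
apply: (@Rle_trans _ (INR (#|F i| + #|A|))); last by rewrite plus_INR; lra.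
exact/le_INR/leP/leq_card_setU.
Qed.

(** Independent nodes are more than [radius ph] apart, so their density is 1, and [packing] with
    [j = 3] gives a bound common to all networks. *)
Lemma crowd_exists : exists2 q, 0 < q & forall ph G (I : {set 'I_(nn G)}),
  phys_ok ph -> independent ph G I ->
  forall y, #|[set w in I | Rleb (nd G w y) (INR 3 * radius ph)]| <= q.
Proof.
exists ((4 * 3).+1 ^ 2) => // ph G I ok indep y; rewrite -[X in _ <= X]mul1n.
apply: packing; first exact: radius_gt0.
move=> x xI; rewrite -(cards1 x); apply: subset_leq_card; apply/subsetP => v.
rewrite !inE => /andP[vI near]; apply: contraTT (indep _ _ xI vI) => vx.
by rewrite negbK /adj eq_sym vx.
Qed.

Lemma dense_all ph G D : max_degree ph G D ->
  dense_le (radius ph) [set: 'I_(nn G)] D.+1.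
Proof.
case=> deg _ x _; apply: (@leq_trans #|x |: [set y | adj ph G x y]|).
  apply: subset_leq_card; apply/subsetP => y; rewrite !inE /= /adj => le.
  by rewrite le andbT eq_sym orbN.
by apply: leq_trans (leq_card_setU _ _) _; rewrite cards1 add1n ltnS deg.
Qed.

(** Since [n < 2 ^ log2N N], three of the [d + 3] factors [2 ^ log2N N] absorb the 2 and the two
    factors [n] for the pairs; the other [d] absorb [n ^ d]. *)
Lemma union_bound_le n N d : 0 < n -> n <= N ->
  (INR n * INR n * (2 * (/ 2) ^ ((d + 3) * log2N N)) <= / (INR n ^ d))%Re.
Proof.
move=> n0 nN; have nL := ltn_log2N nN; set L := log2N N in nL *.
have nr : (0 < INR n)%Re by apply/lt_0_INR/ltP.
have nd0 : (0 < INR n ^ d)%Re by apply: pow_lt.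
have e0 : (0 < 2 ^ ((d + 3) * L))%Re by apply: pow_lt; lra.
have key : (2 * (INR n * INR n) * INR n ^ d <= 2 ^ ((d + 3) * L))%Re.
  rewrite -INR_expn (_ : 2 = INR 2)%Re // -INR_expn -!mult_INR; apply/le_INR/leP.
  have -> : 2 ^ ((d + 3) * L) = (2 ^ L) ^ 3 * (2 ^ L) ^ d by rewrite mulnC expnM addnC expnD.
  apply: leq_mul.
    set e := 2 ^ L in nL *; rewrite !multE !expnS expn0 muln1.
    by apply: leq_mul; [lia|apply: leq_mul; lia].
  by case: d {nd0 e0} => // d; rewrite leq_exp2r // ltnW.
rewrite pow_inv; apply: (Rmult_le_reg_r (2 ^ ((d + 3) * L) * INR n ^ d)).
  exact: Rmult_lt_0_compat.
apply: (Rle_trans _ (2 * (INR n * INR n) * INR n ^ d)); last apply: (Rle_trans _ _ _ key).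
  by apply: Req_le; field; lra.
by apply: Req_le; field; lra.
Qed.

Theorem theorem3 :
  forall ph : phys, phys_ok ph ->
  forall d : nat,
  exists (S : Type) (A : algorithm S) (c : nat),
    (* messages carry O(log N) bits *)
    (forall N D t s k m, al_send A N D t s k = Some m -> size m <= c * log2N N) /\
    (* running time O(Delta log^7 N) *)
    (forall N D, al_T A N D <= c * D.+1 * log2N N ^ 7) /\
    forall (N D : nat) (G : network) (I : {set 'I_(nn G)}),
      0 < nn G -> nn G <= N ->
      injective (nname G) ->
      (forall x, 1 <= nname G x <= N) ->
      (forall x y : 'I_(nn G), x <> y -> npos G x <> npos G y) ->
      graph_connected ph G ->
      max_degree ph G D ->
      maximal_independent ph G I ->
      (prob S A G N D
         (fun w => connectbb_success ph G N D c (final_output S A ph G N D I w))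
       >= 1 - / (INR (nn G) ^ d))%Re.
Proof.
move=> ph ok d; have [q q0 crowd] := crowd_exists.
have [kp hkp] := INR_unbounded (2 * kappa ph).
have kp0 : 0 < kp.
  by apply/ltP/INR_lt; have := kappa_ge25 ok; rewrite /=; lra.
have [M0 M0E] : {k | k = q * (q * q + q).+1} by eexists.
have M00 : 0 < M0 by rewrite M0E muln_gt0 q0.
have [a aE] : {k | k = kp * (d + 3)} by eexists.
have a0 : 0 < a by rewrite aE muln_gt0 kp0 addn3.
have [e1 e1E] : {k | k = M0.+1 * (2 * a * M0)} by eexists.
have [e2 e2E] : {k | k = 2 * a * M0} by eexists.
(* Both lengths have the form [2 * K * m] of [broadcast_failure], with [1 / K] the transmission
   probability and [m] chosen for [union_bound_le]. *)
pose len1 N D := 2 * (kp * D.+1) * ((d + 3) * log2N N).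
pose len2 N (D : nat) := 2 * (kp * M0) * ((d + 3) * log2N N).
(* [c] adds up the demands: 8 for the diameter, [q.+2] for messages, [M0] for size and density,
   [10 * a] and [e2] for the running time, [e1] for Inter; Intra needs [2 * a]. *)
pose c := 8 + q.+2 + M0 + 10 * a + e1 + e2.
(* One coin range of [kp * M0 * D.+1] values serves both probabilities: threshold [M0] gives
   [1 / (kp * D.+1)] for all nodes, threshold [D.+1] gives [1 / (kp * M0)] for the backbone. *)
pose A := connectbb (fun N _ => log2N N) (fun N _ => q.+2 * log2N N) len1 len2
  (fun _ _ => M0) (fun _ D => D.+1) (fun _ D => (kp * M0 * D.+1).-1).
have L0 N : 0 < log2N N by rewrite /log2N addn1.
have len1E N D : len1 N D = 2 * a * D.+1 * log2N N by rewrite /len1 aE; lia.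
have len2E N D : len2 N D = e2 * log2N N by rewrite /len2 e2E aE; lia.
exists memory, A, c; split; [|split].
- move=> N D t s k m /= h; apply: (@leq_trans (q.+2 * log2N N)).
    (* The bound holds in every state, reachable or not, because [send] truncates. *)
    move: h; rewrite /send; case: ifP => _; case: ifP => // _ [<-];
      by rewrite size_take; case: ltnP => // /leq_trans; apply.
  by rewrite leq_mul2r; apply/orP; right; rewrite /c; lia.
- move=> N D; rewrite /= len1E len2E.
  (* A single logarithmic factor suffices; the other six only weaken the bound. *)
  apply: (@leq_trans (c * D.+1 * log2N N)).
    rewrite !mulnA -mulnDl leq_mul2r; apply/orP; right.
    apply: (@leq_trans ((10 * a + e2) * D.+1)).
      by have := leq_pmulr e2 (ltn0Sn D); lia.
    by rewrite leq_mul2r /c; lia.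
  by rewrite leq_mul2l expnS leq_pmulr ?orbT // expn_gt0 L0.
move=> N D G I n0 nN name_inj name_bd pos_inj conn maxD I_max.
have name_le x : nname G x <= N by case/andP: (name_bd x).
have {}crowd := crowd ph G I ok (proj1 I_max).
set m := (d + 3) * log2N N.
set Q := (kp * M0 * D.+1).-1.
have QE : Q.+1 = kp * M0 * D.+1 by rewrite prednK // muln_gt0 muln_gt0 kp0 M00.
set T := al_T A N D; have TE : T = 5 * len1 N D + len2 N D by [].
(* [H] comes from the lossless exchange and so does not depend on the tape: failures of the
   announcement rounds are counted without conditioning on the earlier ones. *)
pose H : {set 'I_(nn G)} := [set x | member ph N I x].
pose B1 := [set t : 'I_T | t < len1 N D].
pose B2 := [set t : 'I_T | 5 * len1 N D <= t].
have card_lt k : k <= T -> #|[set t : 'I_T | t < k]| = k.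
  by move=> kT; rewrite -sum1_card (eq_bigl (fun t : 'I_T => t < k)) => [|t];
    rewrite ?inE // -(big_ord_widen _ (fun=> 1) kT) sum1_card card_ord.
have cB1 : #|B1| = 2 * (kp * D.+1) * m by rewrite card_lt // TE; lia.
have cB2 : #|B2| = 2 * (kp * M0) * m.
  have := cardsC [set t : 'I_T | t < 5 * len1 N D].
  rewrite card_lt ?card_ord ?TE ?leq_addr // => /addnI e.
  by rewrite -[RHS]/(len2 N D) -e; apply: eq_card => t; rewrite !inE -leqNgt.
have dense_H : dense_le (radius ph) H M0.
  move=> x _; rewrite M0E; apply: leq_trans (member_dense N ok name_inj crowd x).
  by apply: subset_leq_card; apply/subsetP => y; rewrite !inE.
pose bad (X : {set 'I_(nn G)}) z (B : {set 'I_T}) (p : 'I_(nn G) * 'I_(nn G)) :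
    {set tape memory A G N D} :=
  [set w : tape memory A G N D | [forall t in B, ~~ rcv ph G (active X z [ffun x => w (x, t)]) p.1 p.2]].
pose edge (X : {set 'I_(nn G)}) (p : 'I_(nn G) * 'I_(nn G)) := (p.1 \in X) && adj ph G p.1 p.2.
(* For each ordered pair there are two failures: never received in the first [len1] rounds, or, for
   a sender in [H], never received in the announcement rounds. *)
pose fail := \bigcup_(p | true)
  ((if edge setT p then bad setT M0 B1 p else set0) :|:
   (if edge H p then bad H D.+1 B2 p else set0)).
have heard_of X z B u y (w : tape memory A G N D) (f : nat -> 'I_(nn G) -> bool) :
    w \notin bad X z B (u, y) ->
    (forall t : 'I_T, t \in B -> active X z [ffun x => w (x, t)] =1 f t) ->
    exists2 t : 'I_T, t \in B & rcv ph G (f t) u y.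
  rewrite inE => /forall_inPn[t tB /negPn r] e; exists t => //.
  by rewrite -(eq_rcv _ _ _ (e t tB)).
have coinE (w : tape memory A G N D) x (t : 'I_T) : coin memory A G N D w x t = w (x, t).
  by rewrite /coin valK.
have success w : w \notin fail ->
    connectbb_success ph G N D c (final_output memory A ph G N D I w).
  move=> /bigcupP wF.
  have notbad X z B p : (X, z, B) \in [:: (setT, M0, B1); (H, D.+1, B2)] ->
      edge X p -> w \notin bad X z B p.
    rewrite !in_cons in_nil orbF => XzB ep; apply/negP => wb; apply: wF; exists p => //.
    rewrite in_setU; case/orP: XzB => /eqP[eX ez eB]; move: ep wb; rewrite eX ez eB => -> ->;
      by rewrite ?orbT.
  apply: (@outcome_success (fun N _ => log2N N) (fun N _ => q.+2 * log2N N) len1 len2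
    (fun _ _ => M0) (fun _ D => D.+1) (fun _ D => (kp * M0 * D.+1).-1)
    ph G N D I ok name_inj name_le I_max q crowd) => //.
  + by move=> k; apply: ltn_log2N.
  + by rewrite len1E !muln_gt0 a0 L0.
  + move=> u y uy.
    have nb : w \notin bad setT M0 B1 (u, y).
      by apply: notbad; rewrite ?inE ?eqxx // /edge inE.
    have [|t tB r] := heard_of _ _ _ _ _ _
      (@on1 (fun N _ => log2N N) (fun N _ => q.+2 * log2N N) len1 len2
        (fun _ _ => M0) (fun _ D => D.+1) (fun _ D => (kp * M0 * D.+1).-1) G N D w) nb.
      by move=> t tB x; rewrite /active inE /on1 coinE ffunE.
    by exists t => //; rewrite inE in tB.
  + move=> u y uH uy.
    have nb : w \notin bad H D.+1 B2 (u, y).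
      by apply: notbad; rewrite ?inE ?eqxx ?orbT // /edge inE uH.
    have [|t tB r] := heard_of _ _ _ _ _ _
      (fun t => @on2 (fun N _ => log2N N) (fun N _ => q.+2 * log2N N) len1 len2
        (fun _ _ => M0) (fun _ D => D.+1) (fun _ D => (kp * M0 * D.+1).-1) ph G N D I w
        (t - 5 * len1 N D)) nb.
      move=> t; rewrite inE => tB x.
      by rewrite /active inE /on2 subnKC // coinE ffunE.
    exists (t - 5 * len1 N D) => //.
    have tT : t < 5 * len1 N D + len2 N D by rewrite -TE.
    by move: tB; rewrite inE; lia.
  + by rewrite -M0E /c; lia.
  + by rewrite -M0E len2E mulnA e2E -e1E leq_mul2r; apply/orP; right; rewrite /c; lia.
  + by rewrite len1E leq_mul2r leq_mul2r /c; lia.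
have kr : (2 * kappa ph <= INR kp)%Re by lra.
(* The condition [M * z = M0 * D.+1] treats both events at once, as density and threshold swap roles
   between them. *)
have fail_le X M z K (B : {set 'I_T}) p : dense_le (radius ph) X M -> M * z = M0 * D.+1 ->
    z <= Q.+1 -> Q.+1 <= K * z -> #|B| = 2 * K * m ->
    (INR #|if edge X p then bad X z B p else set0| <=
     (/ 2) ^ m * INR #|{: tape memory A G N D}|)%Re.
  move=> dX Mz zQ QK cB; case: ifP => [/andP[uX uy]|_]; last first.
    rewrite cards0; apply: Rmult_le_pos (pos_INR _); apply: pow_le; lra.
  apply: (broadcast_failure ok pos_inj dX uX uy _ zQ QK cB).
  rewrite QE -mulnA -Mz !mult_INR.
  have := pos_INR M; have := pos_INR z => z0 M0'.
  have -> : (2 * INR M * kappa ph * INR z = 2 * kappa ph * (INR M * INR z))%Re by ring.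
  by apply: Rmult_le_compat_r => //; apply: Rmult_le_pos.
set tot := INR #|{: tape memory A G N D}|.
have tot0 : (0 < tot)%Re.
  by apply/lt_0_INR/ltP/card_gt0P; exists [ffun=> ord0].
have card_fail : (INR #|fail| <= INR (nn G) * INR (nn G) * (2 * (/ 2) ^ m) * tot)%Re.
  have cP : #|fun _ : 'I_(nn G) * 'I_(nn G) => true| = (nn G * nn G)%N.
    by rewrite -[in RHS](card_ord (nn G)) -card_prod; apply: eq_card.
  rewrite Rmult_assoc -mult_INR multE -cP; apply: card_bigcup_Rle => p _.
  apply: Rle_trans (le_INR _ _ (elimT leP (leq_card_setU _ _))) _.
  rewrite plus_INR.
  have h1 := @fail_le setT D.+1 M0 (kp * D.+1) B1 p (dense_all maxD).
  have h2 := @fail_le H M0 D.+1 (kp * M0) B2 p dense_H.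
  have z1 : M0 <= Q.+1 by rewrite QE -mulnA mulnCA leq_pmulr // muln_gt0 kp0.
  have z2 : D.+1 <= Q.+1 by rewrite QE leq_pmull // muln_gt0 kp0.
  have k1 : Q.+1 <= kp * D.+1 * M0 by rewrite QE mulnAC.
  have k2 : Q.+1 <= kp * M0 * D.+1 by rewrite QE.
  have := h1 (mulnC _ _) z1 k1 cB1; have := h2 erefl z2 k2 cB2; rewrite -/tot; lra.
apply: Rle_ge; apply: (@Rle_trans _ (1 - INR #|fail| / tot)).
  have := union_bound_le d n0 nN; rewrite -/m => ub.
  suff : (INR #|fail| / tot <= INR (nn G) * INR (nn G) * (2 * (/ 2) ^ m))%Re by lra.
  apply: (Rmult_le_reg_r tot) => //.
  by rewrite /Rdiv Rmult_assoc Rinv_l; lra.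
rewrite /prob -/tot; apply: (Rmult_le_reg_r tot) => //.
rewrite Rmult_minus_distr_r /Rdiv !Rmult_assoc Rinv_l; last lra.
set good := [set w | _].
suff : (tot <= INR #|good| + INR #|fail|)%Re by lra.
rewrite -plus_INR; apply/le_INR/leP; apply: leq_trans (leq_card_setU _ _).
apply: subset_leq_card; apply/subsetP => w _; rewrite inE orbC.
by case: (boolP (w \in fail)) => //= /success h; rewrite inE; apply/to_boolP.
Qed.
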